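(* Let $C=\{c_k\}_{k\in\mathbb{N}}$ be a sequence of real numbers and $m\in\mathbb{N}$, and let $\mathcal{M}(C_m)=H_1^{-1}(c_1)\cap\dots\cap H_m^{-1}(c_m)\subset\mathcal{M}$, assumed non-empty. On $\mathcal{M}(C_m)$, for each $n\in\mathbb{N}$ and each $k=0,1,\dots,m+1$, the vector field $X_n$ is a Hamiltonian vector field for $H_{n+k}$ with respect to $\omega_k$, i.e. $\omega_k(X_n,\,\cdot\,)=dH_{n+k}$ on $\mathcal{M}(C_m)$; that is, the set $\bigl(\{H_n\}_{n\in\mathbb{N}},\{\omega_k\}_{k=0}^{m+1}\bigr)$ is a multi-Hamiltonian system on $\mathcal{M}(C_m)$ describing the higher KdV flows $\gamma_t=X_n$.
   Context: All maps are smooth, $\mathbb{N}=\{1,2,\dots\}$, $S^1=\mathbb{R}/2\pi\mathbb{Z}$, subscript $s$ is the derivative with respect to the parameter $s\in S^1$, $D_s=\partial/\partial s$. Space of curves. $\mathcal{M}=\{\gamma:S^1\to\mathbb{R}^2\setminus\{0\} : \det\begin{pmatrix}\gamma\\ \gamma_s\end{pmatrix}=1\}$ (closed equicentroaffine plane curves). The equicentroaffine curvature $\kappa:S^1\to\mathbb{R}$ of $\gamma$ is defined by $\gamma_{ss}=-\kappa\gamma$. The tangent space is $T_\gamma\mathcal{M}=\{-\frac12\alpha_s\gamma+\alpha\gamma_s : \alpha:S^1\to\mathbb{R}\}$. Under a motion $\gamma_t=-\frac12\alpha_s\gamma+\alpha\gamma_s$ one has $\kappa_t=\Omega\alpha_s=\frac12\alpha_{sss}+2\kappa\alpha_s+\kappa_s\alpha$.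 Recursion operator. $\Omega=\frac12D_s^2+2\kappa+\kappa_sD_s^{-1}$. For a function $f$ on $S^1$ with $\int_{S^1}f\,ds=0$, $D_s^{-1}f$ is an antiderivative of $f$ on $S^1$; for given $\alpha$, $D_s^{-1}\alpha_s=\alpha$. For expressions polynomial in $\kappa$ and its derivatives, such as $D_s^{-1}\Omega^{n-1}\kappa_s$, $D_s^{-1}$ denotes the antiderivative which is a polynomial in $\kappa,\kappa_s,\kappa_{ss},\dots$ without constant term. Hamiltonians. $H_m=\int_{S^1}h_m(\kappa,\kappa_s,\kappa_{ss},\dots)\,ds$ $(m\in\mathbb{N})$ is the standard infinite series of conserved quantities of the KdV hierarchy $\kappa_t=\Omega^n\kappa_s$: $h_m$ is a polynomial in $\kappa$ and its derivatives up to order $m$, weighted homogeneous of weight $2m$ when the $j$-th derivative of $\kappa$ has weight $j+2$, with $h_1=\kappa$ and $D_s\frac{\delta H_{n+2}}{\delta\kappa}=\Omega^n\kappa_s$ for $n\ge 0$, where $\frac{\delta H}{\delta\kappa}=\frac{\partial h}{\partial\kappa}-D_s\frac{\partial h}{\partial\kappa_s}+D_s^2\frac{\partial h}{\partial\kappa_{ss}}-\cdots$ for $H=\int_{S^1}h\,ds$. E.g. $h_2=\frac12\kappa^2$, $h_3=\frac12\kappa^3-\frac14\kappa_s^2$. The $H_m$ are regarded as functions on $\mathcal{M}$ via the curvature $\kappa$ of $\gamma$. Vector fields. $(X_n)_\gamma=-\frac12(\Omega^{n-1}\kappa_s)\gamma+(D_s^{-1}\Omega^{n-1}\kappa_s)\gamma_s$,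 $n\in\mathbb{N}$; the flow $\gamma_t=X_n$ is the $n$th KdV flow, under which $\kappa_t=\Omega^n\kappa_s$. The vector fields $X_n$ are tangent to $\mathcal{M}(C_m)$. Forms. The tangent space of $\mathcal{M}(C_m)$ at $\gamma$ is $T_\gamma\mathcal{M}(C_m)=\{X\in T_\gamma\mathcal{M} : dH_1(X)=\dots=dH_m(X)=0\}$. For $X=-\frac12\alpha_s\gamma+\alpha\gamma_s$ and $Y=-\frac12\beta_s\gamma+\beta\gamma_s$: on $\mathcal{M}$, $\omega_0(X,Y)=\int_{S^1}\det\begin{pmatrix}X\\ Y\end{pmatrix}ds=\int_{S^1}\alpha\beta_s\,ds$ and $\omega_1(X,Y)=\int_{S^1}\det\begin{pmatrix}X\\ (D_s^2+\kappa)Y\end{pmatrix}ds=\int_{S^1}\alpha\,\Omega\beta_s\,ds$; on $\mathcal{M}(C_j)$ ($j\in\mathbb{N}$), $\omega_{j+1}(X,Y)=\int_{S^1}\alpha\,\Omega^{j+1}\beta_s\,ds$, where for $Y\in T_\gamma\mathcal{M}(C_j)$ the functions $\Omega\beta_s,\dots,\Omega^{j+1}\beta_s$ are well defined on $S^1$ up to constants of integration, whose choice does not affect $\omega_{j+1}$. On $\mathcal{M}(C_m)$ the forms $\omega_0,\omega_1,\dots,\omega_m$ denote the restrictions of $\omega_0,\omega_1$ from $\mathcal{M}$ and of $\omega_{j+1}$ from $\mathcal{M}(C_j)$, $1\le j\le m-1$. A presymplectic form is a closed (possibly degenerate) 2-form; ''multi-Hamiltonian system'' means that the $\omega_k$ are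 presymplectic forms and each $X_n$ is Hamiltonian for $H_{n+k}$ with respect to every $\omega_k$. *)

(* Defs.v *)
(* Stdlib reals with Coquelicot. *)
From Stdlib Require Export Reals Lra Lia ClassicalEpsilon.
From Coquelicot Require Export Coquelicot.
Open Scope R_scope.

(** * Loops and plane curves *)

(* Functions on S^1 = R/2piZ are 2pi-periodic functions on R. *)
Definition loop (f : R -> R) : Prop :=
  (forall n s, ex_derive_n f n s) /\ (forall s, f (s + 2 * PI) = f s).

Definition integral_S1 (f : R -> R) : R := RInt f 0 (2 * PI).

Definition curve := R -> R * R.

Definition xc (g : curve) : R -> R := fun s => fst (g s).
Definition yc (g : curve) : R -> R := fun s => snd (g s).

Definition comb (a : R) (p : R * R) (b : R) (q : R * R) : R * R :=
  (a * fst p + b * fst q, a * snd p + b * snd q).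

Definition det (p q : R * R) : R := fst p * snd q - snd p * fst q.

Definition D_n (n : nat) (g : curve) : curve :=
  fun s => (Derive_n (xc g) n s, Derive_n (yc g) n s).

Definition M (g : curve) : Prop :=
  loop (xc g) /\ loop (yc g) /\
  (forall s, g s <> (0, 0)) /\
  (forall s, det (g s) (D_n 1 g s) = 1).

(* A closed formula for the function kappa determined by
   g_ss = - kappa g; see [curvatureE]. *)
Definition curvature (g : curve) : R -> R :=
  fun s => det (D_n 1 g s) (D_n 2 g s).

Lemma curvatureE (g : curve) (s : R) :
  M g -> D_n 2 g s = (- curvature g s * xc g s, - curvature g s * yc g s).
Proof.
intros [[Hx _] [[Hy _] [_ Hd]]].
assert (H1 : det (g s) (D_n 1 g s) = 1) by apply Hd.
assert (H2 : det (g s) (D_n 2 g s) = 0).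
{ assert (E : Derive (fun t => det (g t) (D_n 1 g t)) s = 0).
  { rewrite (Derive_ext _ (fun _ => 1)) by exact Hd. apply Derive_const. }
  rewrite <- E; clear E.
  assert (Ex := Hx 1%nat s). assert (Ey := Hy 1%nat s).
  assert (Ex2 := Hx 2%nat s). assert (Ey2 := Hy 2%nat s).
  change (det (g s) (D_n 2 g s) =
    Derive (fun t => xc g t * Derive_n (yc g) 1 t - yc g t * Derive_n (xc g) 1 t) s).
  change (ex_derive (xc g) s) in Ex. change (ex_derive (yc g) s) in Ey.
  change (ex_derive (Derive_n (xc g) 1) s) in Ex2.
  change (ex_derive (Derive_n (yc g) 1) s) in Ey2.
  rewrite Derive_minus; try (apply ex_derive_mult; assumption).
  rewrite !Derive_mult by assumption.
  change (Derive (Derive_n (xc g) 1) s) with (Derive_n (xc g) 2 s).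
  change (Derive (Derive_n (yc g) 1) s) with (Derive_n (yc g) 2 s).
  change (Derive (xc g) s) with (Derive_n (xc g) 1 s).
  change (Derive (yc g) s) with (Derive_n (yc g) 1 s).
  unfold det, D_n; cbn [fst snd].
  change (fst (g s)) with (xc g s). change (snd (g s)) with (yc g s). ring. }
unfold curvature.
revert H1 H2. unfold det, xc, yc.
destruct (g s) as [x y], (D_n 1 g s) as [x1 y1], (D_n 2 g s) as [x2 y2].
simpl. intros H1 H2. f_equal.
- transitivity (x2 * (x * y1 - y * x1) - x1 * (x * y2 - y * x2)).
  + rewrite H1, H2. ring.
  + ring.
- transitivity (y2 * (x * y1 - y * x1) - y1 * (x * y2 - y * x2)).
  + rewrite H1, H2. ring.
  + ring.
Qed.

(** * Differential polynomials in kappa *)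

(* Terms for polynomials in kappa, kappa_s, kappa_ss, ...; [dvar j] is the
   j-th derivative of kappa.  Two terms denote the same polynomial iff they
   take the same value at every u : nat -> R (R is infinite): [dp_eq]. *)
Inductive dpoly : Type :=
  | dconst (c : R)
  | dvar (j : nat)
  | dadd (p q : dpoly)
  | dmul (p q : dpoly).

Fixpoint deval (p : dpoly) (u : nat -> R) : R :=
  match p with
  | dconst c => c
  | dvar j => u j
  | dadd p q => deval p u + deval q u
  | dmul p q => deval p u * deval q u
  end.

Definition dp_eq (p q : dpoly) : Prop := forall u, deval p u = deval q u.

(* The total derivative D_s. *)
Fixpoint dtot (p : dpoly) : dpoly :=
  match p with
  | dconst _ => dconst 0
  | dvar j => dvar (S j)
  | dadd p q => dadd (dtot p) (dtot q)
  | dmul p q => dadd (dmul (dtot p) q) (dmul p (dtot q))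
  end.

(* The partial derivative with respect to the j-th derivative of kappa. *)
Fixpoint dpart (j : nat) (p : dpoly) : dpoly :=
  match p with
  | dconst _ => dconst 0
  | dvar i => dconst (if Nat.eqb i j then 1 else 0)
  | dadd p q => dadd (dpart j p) (dpart j q)
  | dmul p q => dadd (dmul (dpart j p) q) (dmul p (dpart j q))
  end.

Fixpoint dord (p : dpoly) : nat :=
  match p with
  | dconst _ => 0%nat
  | dvar j => j
  | dadd p q | dmul p q => Nat.max (dord p) (dord q)
  end.

Fixpoint euler_upto (N : nat) (p : dpoly) : dpoly :=
  match N with
  | O => dpart 0 p
  | S N' => dadd (euler_upto N' p)
              (dmul (dconst ((-1) ^ N)) (Nat.iter N dtot (dpart N p)))
  end.

(* The variational derivative; [dpart j p] vanishes for j > dord p. *)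
Definition vder (p : dpoly) : dpoly := euler_upto (dord p) p.

(* D_s^{-1} on differential polynomials: a polynomial primitive without
   constant term, unique up to [dp_eq] when it exists. *)
Definition is_dprim (p q : dpoly) : Prop :=
  dp_eq (dtot q) p /\ deval q (fun _ => 0) = 0.

Definition dinv (p : dpoly) : dpoly := epsilon (inhabits (dconst 0)) (is_dprim p).

(* [kdv n] is Omega^n kappa_s. *)
Fixpoint kdv (n : nat) : dpoly :=
  match n with
  | O => dvar 1
  | S n' =>
      let f := kdv n' in
      dadd (dadd (dmul (dconst (1 / 2)) (dtot (dtot f)))
                 (dmul (dconst 2) (dmul (dvar 0) f)))
           (dmul (dvar 1) (dinv f))
  end.

Definition order_le (m : nat) (p : dpoly) : Prop :=
  forall u v : nat -> R, (forall j, (j <= m)%nat -> u j = v j) ->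
  deval p u = deval p v.

Definition weight_homogeneous (w : nat) (p : dpoly) : Prop :=
  forall (l : R) (u : nat -> R),
  deval p (fun j => l ^ (j + 2) * u j) = l ^ w * deval p u.

(* The densities h_1, h_2, ... ; [h 0] is irrelevant.  These conditions
   determine each h_m up to a total derivative. *)
Definition kdv_densities (h : nat -> dpoly) : Prop :=
  (forall m, (1 <= m)%nat ->
     order_le m (h m) /\ weight_homogeneous (2 * m) (h m)) /\
  dp_eq (h 1%nat) (dvar 0) /\
  (forall n, dp_eq (dtot (vder (h (n + 2)%nat))) (kdv n)).

Definition jet (k : R -> R) (s : R) : nat -> R := fun j => Derive_n k j s.

Definition Ham (p : dpoly) (g : curve) : R :=
  integral_S1 (fun s => deval p (jet (curvature g) s)).

(** * Smooth families of curves *)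

(* For finite-dimensional V these are the usual C^k and C^infinity functions. *)
Fixpoint Ck {V : NormedModule R_AbsRing} (k : nat) (f : V -> R) : Prop :=
  (forall x, continuous f x) /\
  match k with
  | O => True
  | S k' => forall v : V,
      (forall x, ex_derive (fun t : R => f (plus x (scal t v))) 0) /\
      Ck k' (fun x => Derive (fun t : R => f (plus x (scal t v))) 0)
  end.

Definition Cinf {V : NormedModule R_AbsRing} (f : V -> R) : Prop :=
  forall k, Ck k f.

(* Jointly smooth families of curves in A parametrised by V. *)
Definition plot {V : NormedModule R_AbsRing} (A : curve -> Prop)
    (G : V -> curve) : Prop :=
  Cinf (V := prod_NormedModule R_AbsRing V R_NormedModule)
    (fun p => xc (G (fst p)) (snd p)) /\
  Cinf (V := prod_NormedModule R_AbsRing V R_NormedModule)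
    (fun p => yc (G (fst p)) (snd p)) /\
  (forall x, A (G x)).

Definition velocity {V : NormedModule R_AbsRing} (G : V -> curve) (x v : V) : curve :=
  fun s => (Derive (fun t : R => xc (G (plus x (scal t v))) s) 0,
            Derive (fun t : R => yc (G (plus x (scal t v))) s) 0).

(** * Tangent vectors and differentials *)

Definition tvec (g : curve) (a : R -> R) : curve :=
  fun s => comb (- (1 / 2) * Derive a s) (g s) (a s) (D_n 1 g s).

Definition TM (g X : curve) : Prop :=
  exists a, loop a /\ forall s, X s = tvec g a s.

Definition variation (g X : curve) (G : R_NormedModule -> curve) : Prop :=
  plot M G /\ (forall s, G 0 s = g s) /\ (forall s, velocity G 0 1 s = X s).

(* dH(X) = l at g, for a function H on M. *)
Definition is_dH (H : curve -> R) (g X : curve) (l : R) : Prop :=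
  (exists G, variation g X G) /\
  (forall G, variation g X G -> is_derive (fun t : R => H (G t)) 0 l).

Definition MC (h : nat -> dpoly) (c : nat -> R) (m : nat) (g : curve) : Prop :=
  M g /\ forall j, (1 <= j <= m)%nat -> Ham (h j) g = c j.

Definition TMC (h : nat -> dpoly) (m : nat) (g X : curve) : Prop :=
  TM g X /\ forall j, (1 <= j <= m)%nat -> is_dH (Ham (h j)) g X 0.

(** * The forms omega_k *)

(* Omega f, where F is the chosen primitive D_s^{-1} f. *)
Definition Omega (k f F : R -> R) : R -> R :=
  fun s => 1 / 2 * Derive_n f 2 s + 2 * k s * f s + Derive k s * F s.

(* E i = Omega^i b_s for i <= n, with D_s^{-1} (E i) = F i for i < n; the
   first primitive is b itself, the others are arbitrary primitives on S^1. *)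
Definition Omega_tower (k b : R -> R) (n : nat) (E F : nat -> R -> R) : Prop :=
  (forall s, E 0%nat s = Derive b s) /\
  (forall s, F 0%nat s = b s) /\
  (forall i, (i < n)%nat ->
     loop (F i) /\
     (forall s, Derive (F i) s = E i s) /\
     (forall s, E (S i) s = Omega k (E i) (F i) s)).

(* omega_n(X, Y) = l for some choice of the constants of integration. *)
Definition is_omega (n : nat) (g X Y : curve) (l : R) : Prop :=
  match n with
  | 0%nat => l = integral_S1 (fun s => det (X s) (Y s))
  | 1%nat =>
      l = integral_S1
            (fun s => det (X s) (comb 1 (D_n 2 Y s) (curvature g s) (Y s)))
  | _ =>
      exists (a b : R -> R) (E F : nat -> R -> R),
        loop a /\ loop b /\
        (forall s, X s = tvec g a s) /\ (forall s, Y s = tvec g b s) /\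
        Omega_tower (curvature g) b n E F /\
        l = integral_S1 (fun s => a s * E n s)
  end.

Definition omega (n : nat) (g X Y : curve) : R :=
  epsilon (inhabits 0) (is_omega n g X Y).

Definition R3 : NormedModule R_AbsRing :=
  prod_NormedModule R_AbsRing
    (prod_NormedModule R_AbsRing R_NormedModule R_NormedModule) R_NormedModule.

(* d w = 0 on A: the pull-back of w along every smooth three-parameter family
   in A is differentiable and satisfies (dw)(u, v, e) = 0 for all constant
   vector fields u, v, e on R^3. *)
Definition closed_form (A : curve -> Prop) (w : curve -> curve -> curve -> R) : Prop :=
  forall G : R3 -> curve, plot A G ->
  forall x u v e : R3,
  let pb (a b y : R3) := w (G y) (velocity G y a) (velocity G y b) in
  exists l1 l2 l3 : R,
    is_derive (fun t : R => pb v e (plus x (scal t u))) 0 l1 /\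
    is_derive (fun t : R => pb e u (plus x (scal t v))) 0 l2 /\
    is_derive (fun t : R => pb u v (plus x (scal t e))) 0 l3 /\
    l1 + l2 + l3 = 0.

(* omega_n is a presymplectic form on A with tangent spaces T; the first clause
   includes that the constants of integration are irrelevant. *)
Definition presymplectic (A : curve -> Prop) (T : curve -> curve -> Prop)
    (n : nat) : Prop :=
  (forall g X Y, A g -> T g X -> T g Y -> exists! l, is_omega n g X Y l) /\
  (forall g X Y, A g -> T g X -> T g Y -> omega n g Y X = - omega n g X Y) /\
  (forall g X X' Y (r r' : R), A g -> T g X -> T g X' -> T g Y ->
     omega n g (fun s => comb r (X s) r' (X' s)) Y
     = r * omega n g X Y + r' * omega n g X' Y) /\
  closed_form A (omega n).

(** * KdV vector fields *)

(* The n-th KdV vector field (n >= 1). *)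
Definition KdV_field (n : nat) (g : curve) : curve :=
  let u := jet (curvature g) in
  fun s => comb (- (1 / 2) * deval (kdv (n - 1)) (u s)) (g s)
                (deval (dinv (kdv (n - 1))) (u s)) (D_n 1 g s).

Definition hamiltonian_field (A : curve -> Prop) (T : curve -> curve -> Prop)
    (w : curve -> curve -> curve -> R) (X : curve -> curve) (H : curve -> R) : Prop :=
  forall g, A g ->
    T g (X g) /\ forall Y, T g Y -> is_dH H g Y (w g (X g) Y).

(* Main.v *)
(** Everything rests on the third order operator P f = f_sss / 2 + 2 k f_s + k_s f
    ([Pop] below), so that Omega f_s = P f and the curvature moves by k_t = P alpha.
    A tangent vector alpha to M(C_m) has a tower of primitives A_0 = alpha,
    D A_(i+1) = P A_i which closes up for i <= m, because the mean of P A_i is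
    dH_(i+1); as P and D are both skew-symmetric, pairings of two towers depend only
    on the sum of the indices.  The gradients of the H_j form such a tower too, which
    gives the Hamiltonian property.

    Closedness.  Let T_i(u) be the tower of the velocity in the direction u of a
    family of curves, normalized by T_i(u) = 0 at s = 0 for i >= 1.  As forms in the
    parameters d T_1 = 0, and d T_(n+2)(u, v) = - sum_(j <= n) [T_(j+1)(u), T_(n+1-j)(v)]
    because P and D are 1-cocycles on the Lie algebra of vector fields of S^1 with
    values in the quadratic differentials.  Since
    omega_(n+3) pairs T_1 with D T_(n+2), its differential is a sum of terms
    D T_1(u) [T_i(v), T_j(e)], which cancels by telescoping the cocycle identities of
    P and D. *)

Require Import Defs.
From Stdlib Require Import FunctionalExtensionality Classical ZArith.

(** * Smooth functions on normed modules *)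

(** The index m + 1 is reached although towers close up only to m, because the form of index r sees
    the last entry only through D T_r = P T_(r-1). Moving recursion steps from one argument to the
    other removes every choice of primitives: the steps land on the tower of X, and of the tower of
    Y only the first entry remains. In the Hamiltonian part a variational derivative and the
    matching tower entry are identified only up to a constant; the constant contributes a multiple
    of dH_1, which vanishes on tangent vectors of M(C_m). In the closedness part the primitives
    depend on parameters. Taken from s = 0 they are jointly smooth on the whole line, periodic or
    not, so an identity between the dT_i with i >= 1 follows from its s-derivative and its trivial
    value at s = 0. Periodicity serves only to integrate by parts and is available up to index m.
    For this reason, and because dT_1 = 0 while d alpha is a bracket, the form of index r >= 2 is
    rewritten with T_1 and T_(r-1) in place of alpha and T_r. Parameters range over any normed
    module, so that one calculus covers variations (over R) and test families (over R^3). *)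

Lemma is_derive_Rmult (f g : R -> R) (x l l' : R) :
  is_derive f x l -> is_derive g x l' ->
  is_derive (fun t => f t * g t) x (l * g x + f x * l').
Proof. intros Hf Hg. apply (is_derive_mult (K := R_AbsRing)); auto. apply Rmult_comm. Qed.

Section Calculus.
Context {V : NormedModule R_AbsRing}.

Definition ddir (v : V) (f : V -> R) (x : V) : R :=
  Derive (fun t : R => f (plus x (scal t v))) 0.

Lemma line_0 (x v : V) : plus x (scal 0 v) = x.
Proof.
transitivity (plus x zero); [f_equal; apply (scal_zero_l (V := V) v)|apply plus_zero_r].
Qed.

Lemma line_line (x v : V) (t t' : R) :
  plus (plus x (scal t v)) (scal t' v) = plus x (scal (t + t') v).
Proof.
rewrite <- plus_assoc. f_equal. symmetry.
apply (scal_distr_r (V := V) t t' v).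
Qed.

(** [Ck] differentiates at parameter 0 only; moving the base point along the line reduces every
    other parameter to that one. *)
Lemma ddir_line (f : V -> R) (x v : V) (t : R) :
  (forall x, ex_derive (fun t : R => f (plus x (scal t v))) 0) ->
  is_derive (fun t : R => f (plus x (scal t v))) t (ddir v f (plus x (scal t v))).
Proof.
intros H.
apply is_derive_ext with
  (fun t' : R => (fun r : R => f (plus (plus x (scal t v)) (scal r v))) (t' - t)).
{ intros t'. cbv beta. rewrite line_line. do 3 f_equal. ring. }
evar_last.
- apply (is_derive_comp (K := R_AbsRing)
    (fun r : R => f (plus (plus x (scal t v)) (scal r v))) (fun t' : R => t' - t)).
  + replace (t - t) with 0 by ring.
    apply Derive_correct, (H (plus x (scal t v))).
  + apply (is_derive_minus (K := R_AbsRing) (fun t' : R => t') (fun _ : R => t)).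
    * apply is_derive_id.
    * apply is_derive_const.
- change ((1 + - 0) * ddir v f (plus x (scal t v)) = ddir v f (plus x (scal t v))).
  ring.
Qed.

Lemma Ck_continuous k (f : V -> R) (x : V) : Ck k f -> continuous f x.
Proof. destruct k; intros H; apply H. Qed.

Lemma Ck_ex k (f : V -> R) (v x : V) :
  Ck (S k) f -> ex_derive (fun t : R => f (plus x (scal t v))) 0.
Proof. intros [_ H]. exact (proj1 (H v) x). Qed.

Lemma Ck_ddir k (f : V -> R) (v : V) : Ck (S k) f -> Ck k (ddir v f).
Proof. intros [_ H]. exact (proj2 (H v)). Qed.

Lemma Ck_S k (f : V -> R) (f' : V -> V -> R) :
  (forall x, continuous f x) ->
  (forall v x, is_derive (fun t : R => f (plus x (scal t v))) 0 (f' v x)) ->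
  (forall v, Ck k (f' v)) -> Ck (S k) f.
Proof.
intros Hc Hd Hk. split; [exact Hc|]. intros v. split.
- intros x. exists (f' v x). apply Hd.
- replace (fun x : V => Derive (fun t : R => f (plus x (scal t v))) 0) with (f' v); [apply Hk|].
  apply functional_extensionality; intros x. symmetry. apply is_derive_unique, Hd.
Qed.

Lemma Ck_is_derive k (f : V -> R) (v x : V) :
  Ck (S k) f -> is_derive (fun t : R => f (plus x (scal t v))) 0 (ddir v f x).
Proof. intros H. apply Derive_correct. now apply (Ck_ex k). Qed.

Lemma Ck_le k (f : V -> R) : Ck (S k) f -> Ck k f.
Proof.
revert f; induction k as [|k IH]; intros f H.
- split; [intros x; now apply (Ck_continuous 1)|exact I].
- apply (Ck_S k f (fun v => ddir v f)).
  + intros x. now apply (Ck_continuous (S (S k))).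
  + intros v x. now apply (Ck_is_derive (S k)).
  + intros v. apply IH. now apply Ck_ddir.
Qed.

Lemma Ck_const k (a : R) : Ck k (fun _ : V => a).
Proof.
revert a; induction k as [|k IH]; intros a.
- split; [intros x; apply continuous_const|exact I].
- apply (Ck_S k _ (fun _ _ => 0)).
  + intros x; apply continuous_const.
  + intros v x. apply (is_derive_const (K := R_AbsRing) (V := R_NormedModule)).
  + intros v. apply IH.
Qed.

Lemma Ck_plus k (f g : V -> R) : Ck k f -> Ck k g -> Ck k (fun x => f x + g x).
Proof.
assert (Hc : forall k f g, Ck k f -> Ck k g -> forall x : V, continuous (fun x => f x + g x) x).
{ intros j f0 g0 Hf Hg x. apply (continuous_plus (V := R_NormedModule) f0 g0);
  now apply (Ck_continuous j). }
revert f g; induction k as [|k IH]; intros f g Hf Hg.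
- split; [now apply (Hc 0%nat)|exact I].
- apply (Ck_S k _ (fun v x => ddir v f x + ddir v g x)).
  + now apply (Hc (S k)).
  + intros v x. apply (is_derive_plus (K := R_AbsRing) (V := R_NormedModule));
    now apply (Ck_is_derive k).
  + intros v. apply IH; now apply Ck_ddir.
Qed.

Lemma Ck_mult k (f g : V -> R) : Ck k f -> Ck k g -> Ck k (fun x => f x * g x).
Proof.
assert (Hc : forall k f g, Ck k f -> Ck k g -> forall x : V, continuous (fun x => f x * g x) x).
{ intros j f0 g0 Hf Hg x. apply (continuous_mult (K := R_AbsRing) f0 g0);
  now apply (Ck_continuous j). }
revert f g; induction k as [|k IH]; intros f g Hf Hg.
- split; [now apply (Hc 0%nat)|exact I].
- apply (Ck_S k _ (fun v x => ddir v f x * g x + f x * ddir v g x)).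
  + now apply (Hc (S k)).
  + intros v x.
    evar_last.
    * apply is_derive_Rmult; apply (Ck_is_derive k); assumption.
    * cbv beta. now rewrite line_0.
  + intros v. apply Ck_plus; apply IH; try (now apply Ck_ddir); now apply Ck_le.
Qed.

Lemma Ck_comp1 k (phi phi' : R -> R) (f : V -> R) :
  (forall x, is_derive phi (f x) (phi' (f x))) ->
  Ck (S k) f -> Ck k (fun x => phi' (f x)) -> Ck (S k) (fun x => phi (f x)).
Proof.
intros Hphi Hf Hk. apply (Ck_S k _ (fun v x => ddir v f x * phi' (f x))).
- intros x. apply (continuous_comp f phi); [now apply (Ck_continuous (S k))|].
  apply (ex_derive_continuous (V := R_NormedModule)). eexists. apply Hphi.
- intros v x.
  apply (is_derive_comp (K := R_AbsRing) (V := R_NormedModule) phi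
          (fun t : R => f (plus x (scal t v)))).
  + rewrite line_0. apply Hphi.
  + now apply (Ck_is_derive k).
- intros v. apply Ck_mult; [now apply Ck_ddir|exact Hk].
Qed.

(** [phi] lists successive derivatives, so the statement is uniform in n and the induction on k can
    pass from [phi n] to [phi (S n)]. *)
Lemma Ck_comp k (phi : nat -> R -> R) (f : V -> R) n :
  (forall n r, is_derive (phi n) r (phi (S n) r)) ->
  Ck k f -> Ck k (fun x => phi n (f x)).
Proof.
intros Hphi. revert n; induction k as [|k IH]; intros n Hf.
- split; [|exact I]. intros x. apply (continuous_comp f (phi n)); [apply Hf|].
  apply (ex_derive_continuous (V := R_NormedModule)). eexists. apply Hphi.
- apply (Ck_comp1 k (phi n) (phi (S n))); auto. apply IH. now apply Ck_le.
Qed.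

Lemma is_derive_invsqrt (r : R) : 0 < r ->
  is_derive (fun r => / sqrt r) r (- (1 / 2) * (/ sqrt r * (/ sqrt r * / sqrt r))).
Proof.
intros H. pose proof (sqrt_lt_R0 _ H).
auto_derive; [split; [lra|split; [lra|auto]]|].
field. lra.
Qed.

(** The derivative of r^(-1/2) is -1/2 times its cube, so each order of differentiability follows
    from the preceding one by products. The weight in [variation_exists] has this form. *)
Lemma Ck_invsqrt k (f : V -> R) :
  (forall x, 0 < f x) -> Ck k f -> Ck k (fun x => / sqrt (f x)).
Proof.
intros HP. induction k as [|k IH]; intros Hf.
- split; [|exact I]. intros x.
  apply (continuous_comp f (fun r => / sqrt r)); [apply Hf|].
  apply (ex_derive_continuous (V := R_NormedModule)). eexists. apply is_derive_invsqrt, HP.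
- apply (Ck_comp1 k (fun r => / sqrt r) (fun r => - (1 / 2) * (/ sqrt r * (/ sqrt r * / sqrt r)))); auto.
  + intros x. apply is_derive_invsqrt, HP.
  + pose proof (IH (Ck_le _ _ Hf)).
    apply (Ck_mult k (fun _ => - (1 / 2))); [apply Ck_const|].
    apply (Ck_mult k (fun x => / sqrt (f x))); [assumption|]. now apply Ck_mult.
Qed.

Lemma Cinf_continuous (f : V -> R) (x : V) : Cinf f -> continuous f x.
Proof. intros H. apply (Ck_continuous 0), H. Qed.

Lemma Cinf_ex (f : V -> R) (v x : V) :
  Cinf f -> ex_derive (fun t : R => f (plus x (scal t v))) 0.
Proof. intros H. apply (Ck_ex 0), H. Qed.

Lemma Cinf_ddir (f : V -> R) (v : V) : Cinf f -> Cinf (ddir v f).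
Proof. intros H k. apply Ck_ddir, H. Qed.

Lemma Cinf_const (a : R) : Cinf (fun _ : V => a).
Proof. intros k. apply Ck_const. Qed.

Lemma Cinf_plus (f g : V -> R) : Cinf f -> Cinf g -> Cinf (fun x => f x + g x).
Proof. intros Hf Hg k. apply Ck_plus; auto. Qed.

Lemma Cinf_mult (f g : V -> R) : Cinf f -> Cinf g -> Cinf (fun x => f x * g x).
Proof. intros Hf Hg k. apply Ck_mult; auto. Qed.

Lemma Cinf_opp (f : V -> R) : Cinf f -> Cinf (fun x => - f x).
Proof.
intros Hf.
replace (fun x => - f x) with (fun x => (-1) * f x)
  by (apply functional_extensionality; intros; ring).
apply Cinf_mult; auto. apply Cinf_const.
Qed.

Lemma Cinf_minus (f g : V -> R) : Cinf f -> Cinf g -> Cinf (fun x => f x - g x).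
Proof. intros Hf Hg. apply Cinf_plus; auto. now apply Cinf_opp. Qed.

Lemma is_derive_line (f : V -> R) (x v : V) (t : R) : Cinf f ->
  is_derive (fun t : R => f (plus x (scal t v))) t (ddir v f (plus x (scal t v))).
Proof. intros H. apply ddir_line. intros y. now apply Cinf_ex. Qed.

Lemma ddir_const (v : V) (a : R) : ddir v (fun _ => a) = fun _ => 0.
Proof. apply functional_extensionality; intros x. unfold ddir. apply Derive_const. Qed.

Lemma ddir_plus (v : V) (f g : V -> R) : Cinf f -> Cinf g ->
  ddir v (fun x => f x + g x) = fun x => ddir v f x + ddir v g x.
Proof.
intros Hf Hg. apply functional_extensionality; intros x. unfold ddir.
apply Derive_plus; [now apply (Cinf_ex f)|now apply (Cinf_ex g)].
Qed.

Lemma ddir_minus (v : V) (f g : V -> R) : Cinf f -> Cinf g ->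
  ddir v (fun x => f x - g x) = fun x => ddir v f x - ddir v g x.
Proof.
intros Hf Hg. apply functional_extensionality; intros x. unfold ddir.
apply Derive_minus; [now apply (Cinf_ex f)|now apply (Cinf_ex g)].
Qed.

Lemma ddir_mult (v : V) (f g : V -> R) : Cinf f -> Cinf g ->
  ddir v (fun x => f x * g x) = fun x => ddir v f x * g x + f x * ddir v g x.
Proof.
intros Hf Hg. apply functional_extensionality; intros x. unfold ddir. rewrite Derive_mult; [now rewrite line_0|now apply (Cinf_ex f)|now apply (Cinf_ex g)].
Qed.

Lemma ddir_scal (v : V) (a : R) (f : V -> R) :
  ddir v (fun x => a * f x) = fun x => a * ddir v f x.
Proof. apply functional_extensionality; intros x. unfold ddir. apply Derive_scal. Qed.

Lemma continuous_plane (f : V -> R) (x u v : V) (a b : R) : Cinf f ->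
  continuity_2d_pt (fun a b : R => f (plus (plus x (scal a u)) (scal b v))) a b.
Proof.
intros H. apply continuity_2d_pt_filterlim.
change (continuous (fun z : R * R => f (plus (plus x (scal (fst z) u)) (scal (snd z) v))) (a, b)).
apply (continuous_comp (fun z : R * R => plus (plus x (scal (fst z) u)) (scal (snd z) v)) f).
2: now apply Cinf_continuous.
apply (continuous_plus (V := V) (fun z : R * R => plus x (scal (fst z) u))
  (fun z : R * R => scal (snd z) v)).
- apply (continuous_plus (V := V) (fun z : R * R => x) (fun z : R * R => scal (fst z) u)).
  + apply continuous_const.
  + apply (continuous_scal_l (K := R_AbsRing) (V := V) (fun z : R * R => fst z) u).
    apply continuous_fst.
- apply (continuous_scal_l (K := R_AbsRing) (V := V) (fun z : R * R => snd z) v).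
  apply continuous_snd.
Qed.

Lemma plane_swap (x u v : V) (a b : R) :
  plus (plus x (scal a u)) (scal b v) = plus (plus x (scal b v)) (scal a u).
Proof. rewrite <- !plus_assoc. f_equal. apply plus_comm. Qed.

(** Schwarz's theorem for the restriction of f to the plane through x spanned by u and v; the mixed
    derivatives are continuous there by [continuous_plane]. *)
Lemma ddir_comm (u v : V) (f : V -> R) : Cinf f ->
  ddir u (ddir v f) = ddir v (ddir u f).
Proof.
intros H. apply functional_extensionality; intros x.
pose (F := fun a b : R => f (plus (plus x (scal a u)) (scal b v))).
assert (E1 : forall a b, is_derive (fun a => F a b) a
   (ddir u f (plus (plus x (scal a u)) (scal b v)))).
{ intros a b. unfold F. rewrite plane_swap.
  apply is_derive_ext with (fun a : R => f (plus (plus x (scal b v)) (scal a u))).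
  - intros t. now rewrite plane_swap.
  - now apply is_derive_line. }
assert (E2 : forall a b, is_derive (fun b => F a b) b
   (ddir v f (plus (plus x (scal a u)) (scal b v)))).
{ intros a b. now apply is_derive_line. }
assert (E1' : forall b, (fun a => Derive (fun t => F t b) a) =
   fun a => ddir u f (plus (plus x (scal a u)) (scal b v))).
{ intros b. apply functional_extensionality; intros a. apply is_derive_unique, E1. }
assert (E1'' : forall a, (fun b => Derive (fun t => F t b) a) =
   fun b => ddir u f (plus (plus x (scal a u)) (scal b v))).
{ intros b. apply functional_extensionality; intros a. apply is_derive_unique, E1. }
assert (E2' : forall b, (fun a => Derive (fun t => F a t) b) =
   fun a => ddir v f (plus (plus x (scal a u)) (scal b v))).
{ intros b. apply functional_extensionality; intros a. apply is_derive_unique, E2. }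
assert (E21 : forall a b, is_derive (fun a => Derive (fun t => F a t) b) a
   (ddir u (ddir v f) (plus (plus x (scal a u)) (scal b v)))).
{ intros a b. rewrite E2'. rewrite plane_swap.
  apply is_derive_ext with (fun a : R => ddir v f (plus (plus x (scal b v)) (scal a u))).
  - intros t. now rewrite plane_swap.
  - apply is_derive_line. now apply Cinf_ddir. }
assert (E12 : forall a b, is_derive (fun b => Derive (fun t => F t b) a) b
   (ddir v (ddir u f) (plus (plus x (scal a u)) (scal b v)))).
{ intros a b. rewrite E1''. apply is_derive_line. now apply Cinf_ddir. }
assert (Hz : plus (plus x (scal 0 u)) (scal 0 v) = x) by now rewrite !line_0.
pose proof (Schwarz F 0 0) as S.
assert (Q1 : Derive (fun z : R => Derive (fun t : R => F z t) 0) 0 = ddir u (ddir v f) x).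
{ etransitivity; [exact (is_derive_unique _ _ _ (E21 0 0))|exact (f_equal _ Hz)]. }
assert (Q2 : Derive (fun z : R => Derive (fun t : R => F t z) 0) 0 = ddir v (ddir u f) x).
{ etransitivity; [exact (is_derive_unique _ _ _ (E12 0 0))|exact (f_equal _ Hz)]. }
rewrite <- Q1, <- Q2. apply S; clear S.
- apply locally_2d_forall. intros a b. repeat split; eexists; [apply E1|apply E2|apply E21|apply E12].
- assert (E : (fun u0 v0 : R => Derive (fun z : R => Derive (fun t : R => F z t) v0) u0)
    = fun a b => ddir u (ddir v f) (plus (plus x (scal a u)) (scal b v))).
  { do 2 (apply functional_extensionality; intros). apply is_derive_unique, E21. }
  rewrite E. apply continuous_plane. now do 2 apply Cinf_ddir.
- assert (E : (fun u0 v0 : R => Derive (fun z : R => Derive (fun t : R => F t z) u0) v0)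
    = fun a b => ddir v (ddir u f) (plus (plus x (scal a u)) (scal b v))).
  { do 2 (apply functional_extensionality; intros). apply is_derive_unique, E12. }
  rewrite E. apply continuous_plane. now do 2 apply Cinf_ddir.
Qed.

End Calculus.

Lemma Cinf_linear {V : NormedModule R_AbsRing} (l : V -> R) :
  (forall x, continuous l x) ->
  (forall x t v, l (plus x (scal t v)) = l x + t * l v) -> Cinf l.
Proof.
intros Hc HL k. destruct k as [|k]; [split; [exact Hc|exact I]|].
apply (Ck_S k _ (fun v _ => l v)).
- exact Hc.
- intros v x. apply is_derive_ext with (fun t => l x + t * l v).
  + intros t. now rewrite HL.
  + auto_derive; auto; ring.
- intros v. apply Ck_const.
Qed.

(** * Families of functions of s *)

Local Ltac Rring := match goal with |- ?a = ?b => change ((a : R) = (b : R)); ring end.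

Lemma abs_RInt_le_const_abs (f : R -> R) (a b M : R) :
  ex_RInt f a b ->
  (forall t, Rmin a b <= t <= Rmax a b -> Rabs (f t) <= M) ->
  Rabs (RInt f a b) <= Rabs (b - a) * M.
Proof.
intros He H. destruct (Rle_dec a b) as [Hab|Hab].
- rewrite Rmin_left, Rmax_right in H by lra. rewrite (Rabs_pos_eq (b - a)) by lra.
  now apply abs_RInt_le_const.
- rewrite Rmin_right, Rmax_left in H by lra.
  rewrite <- (opp_RInt_swap f) by now apply ex_RInt_swap.
  change (Rabs (- RInt f b a) <= Rabs (b - a) * M).
  rewrite Rabs_Ropp, Rabs_minus_sym, (Rabs_pos_eq (a - b)) by lra.
  apply abs_RInt_le_const; [lra|now apply ex_RInt_swap|exact H].
Qed.

Section Families.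
Context {V : NormedModule R_AbsRing}.
Local Notation W := (prod_NormedModule R_AbsRing V R_NormedModule).

Definition ds (f : W -> R) : W -> R := ddir (V := W) (zero, 1) f.
Definition dv (v : V) (f : W -> R) : W -> R := ddir (V := W) (v, 0) f.

Lemma Cinf_ds (f : W -> R) : Cinf f -> Cinf (ds f).
Proof. apply (Cinf_ddir (V := W)). Qed.

Lemma Cinf_dv (v : V) (f : W -> R) : Cinf f -> Cinf (dv v f).
Proof. apply (Cinf_ddir (V := W)). Qed.

Lemma prod_line (y v : V) (s r t : R) :
  plus (G := W) (y, s) (scal (V := W) t (v, r)) = (plus y (scal t v), s + t * r).
Proof. reflexivity. Qed.

Lemma is_derive_dir (f : W -> R) (y v : V) (s r t : R) : Cinf f ->
  is_derive (fun t => f (plus y (scal t v), s + t * r)) t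
    (ddir (V := W) (v, r) f (plus y (scal t v), s + t * r)).
Proof. intros H. exact (is_derive_line (V := W) f (y, s) (v, r) t H). Qed.

Lemma is_derive_ds (f : W -> R) (y : V) (s : R) : Cinf f ->
  is_derive (fun s => f (y, s)) s (ds f (y, s)).
Proof.
intros H.
assert (E : forall t, (plus y (scal t zero), 0 + t * 1) = (y, t)).
{ intros t. apply (f_equal2 pair); [|Rring].
  transitivity (plus y zero); [f_equal; apply (scal_zero_r (V := V) t)|apply plus_zero_r]. }
pose proof (is_derive_dir f y zero 0 1 s H) as D.
unfold ds. rewrite E in D.
apply is_derive_ext with (2 := D). intros t. cbv beta. now rewrite E.
Qed.

Lemma is_derive_dv (f : W -> R) (y v : V) (s t : R) : Cinf f ->
  is_derive (fun t => f (plus y (scal t v), s)) t (dv v f (plus y (scal t v), s)).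
Proof.
intros H.
assert (E : forall t, (plus y (scal t v), s + t * 0) = (plus y (scal t v), s)).
{ intros t'. apply (f_equal2 pair); [reflexivity|Rring]. }
pose proof (is_derive_dir f y v s 0 t H) as D.
unfold dv. rewrite E in D.
apply is_derive_ext with (2 := D). intros t'. cbv beta. now rewrite E.
Qed.

Lemma continuous_strip (f : W -> R) (y v : V) (t s : R) : Cinf f ->
  continuity_2d_pt (fun t s => f (plus y (scal t v), s)) t s.
Proof.
intros H.
assert (E : forall a b : R, plus (G := W) (plus (G := W) (y, 0) (scal (V := W) a (v, 0)))
   (scal (V := W) b (zero, 1)) = (plus y (scal a v), b)).
{ intros a b. rewrite !prod_line. apply (f_equal2 pair); [|Rring].
  transitivity (plus (plus y (scal a v)) zero);
    [f_equal; apply (scal_zero_r (V := V) b)|apply plus_zero_r]. }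
pose proof (continuous_plane (V := W) f (y, 0) (v, 0) (zero, 1) t s H) as D.
replace (fun t s : R => f (plus y (scal t v), s)) with
  (fun a b : R => f (plus (G := W) (plus (G := W) (y, 0) (scal (V := W) a (v, 0)))
   (scal (V := W) b (zero, 1)))); [exact D|].
do 2 (apply functional_extensionality; intros). now rewrite E.
Qed.

Lemma continuous_slice (f : W -> R) (y : V) (s : R) : Cinf f ->
  continuous (fun s => f (y, s)) s.
Proof.
intros H. apply (ex_derive_continuous (V := R_NormedModule)). eexists. now apply is_derive_ds.
Qed.

Lemma ex_RInt_slice (f : W -> R) (y : V) (a b : R) : Cinf f ->
  ex_RInt (fun s => f (y, s)) a b.
Proof.
intros H. apply (ex_RInt_continuous (V := R_CompleteNormedModule)).
intros z _. now apply continuous_slice.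
Qed.

Lemma Derive_dv (f : W -> R) (y v : V) : Cinf f ->
  (fun u s : R => Derive (fun t => f (plus y (scal t v), s)) u) =
  fun u s => dv v f (plus y (scal u v), s).
Proof.
intros H. do 2 (apply functional_extensionality; intros).
apply is_derive_unique. now apply is_derive_dv.
Qed.

Lemma is_derive_integral (f : W -> R) (y v : V) (a b t : R) : Cinf f ->
  is_derive (fun t => RInt (fun s => f (plus y (scal t v), s)) a b) t
    (RInt (fun s => dv v f (plus y (scal t v), s)) a b).
Proof.
intros H.
evar_last.
- apply (is_derive_RInt_param (fun t s => f (plus y (scal t v), s)) a b t).
  + apply filter_forall. intros t' s _. eexists. now apply is_derive_dv.
  + intros s _. rewrite Derive_dv by exact H. apply continuous_strip. now apply Cinf_dv.
  + apply filter_forall. intros t'. now apply ex_RInt_slice.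
- apply RInt_ext. intros s _. apply is_derive_unique. now apply is_derive_dv.
Qed.

Definition prim (f : W -> R) : W -> R := fun p : W => RInt (fun s => f (fst p, s)) 0 (snd p).

(** Leibniz's rule with a moving upper limit. The result is again a primitive plus a smooth
    function, which is what makes the induction in [Cinf_prim] close. *)
Lemma prim_dir (f : W -> R) (y v : V) (s r : R) : Cinf f ->
  is_derive (fun t : R => prim f (plus (G := W) (y, s) (scal (V := W) t (v, r)))) 0
    (prim (dv v f) (y, s) + r * f (y, s)).
Proof.
intros H. unfold prim.
apply is_derive_ext with
  (fun t : R => RInt (fun s => f (plus y (scal t v), s)) 0 (s + t * r)).
{ intros t. reflexivity. }
evar_last.
- apply (is_derive_RInt_param_bound_comp_aux3
    (fun t s => f (plus y (scal t v), s)) 0 (fun t => s + t * r) 0 r).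
  + apply filter_forall. intros t. now apply ex_RInt_slice.
  + exists (mkposreal 1 Rlt_0_1). apply filter_forall. intros t. now apply ex_RInt_slice.
  + auto_derive; auto; ring.
  + exists (mkposreal 1 Rlt_0_1). apply filter_forall. intros t z _.
    eexists. now apply is_derive_dv.
  + intros z _. rewrite Derive_dv by exact H. apply continuous_strip. now apply Cinf_dv.
  + apply locally_2d_forall. intros u z.
    rewrite Derive_dv by exact H. apply continuous_strip. now apply Cinf_dv.
  + apply continuity_pt_filterlim. apply (continuous_slice f). exact H.
- cbv beta. rewrite line_0. replace (s + 0 * r) with s by ring. simpl.
  rewrite (Rmult_comm r). f_equal. apply RInt_ext. intros z _.
  assert (D := is_derive_dv f y v z 0 H). rewrite line_0 in D.
  now apply is_derive_unique.
Qed.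

(** The tube lemma: compactness of [a, b] provides one neighbourhood of y that serves all s, and V
    itself may be far from locally compact. *)
Lemma tube (f : W -> R) (y : V) (a b : R) (eps : posreal) : Cinf f ->
  locally y (fun y' => forall s, a <= s <= b -> Rabs (f (y', s) - f (y, s)) < eps).
Proof.
intros H.
assert (Hd : forall s, exists d : posreal, forall y' s', ball y d y' -> Rabs (s' - s) < 2 * d ->
   Rabs (f (y', s') - f (y, s)) < eps / 2).
{ intros s.
  assert (Hc := Cinf_continuous (V := W) f (y, s) H).
  assert (Hc' := proj1 (filterlim_locally f (f (y, s))) Hc (pos_div_2 eps)).
  destruct Hc' as [d Hd]. exists (pos_div_2 d). intros y' s' Hy Hs.
  apply (Hd (y', s')). split; simpl.
  - apply ball_le with (2 := Hy). simpl. pose proof (cond_pos d). lra.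
  - change (Rabs (s' - s) < d). simpl in Hs. lra. }
set (delta := fun s => proj1_sig (constructive_indefinite_description _ (Hd s))).
assert (Hdelta : forall s y' s', ball y (delta s) y' -> Rabs (s' - s) < 2 * delta s ->
   Rabs (f (y', s') - f (y, s)) < eps / 2).
{ intros s. unfold delta. destruct constructive_indefinite_description as [d Hd']. exact Hd'. }
destruct (compactness_value_1d a b delta) as [d Hc].
exists d. intros y' Hy s Hs.
destruct (NNPP _ (Hc s Hs)) as [t [Ht [Hst Hdt]]].
pose proof (cond_pos (delta t)).
assert (Hst' : Rabs (s - t) < 2 * delta t) by (eapply Rlt_trans; [exact Hst|lra]).
assert (H1 := Hdelta t y' s (ball_le _ _ _ Hdt _ Hy) Hst').
assert (H2 := Hdelta t y s (ball_center _ _) Hst').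
replace (f (y', s) - f (y, s)) with ((f (y', s) - f (y, t)) - (f (y, s) - f (y, t))) by ring.
eapply Rle_lt_trans; [apply Rabs_triang|]. rewrite Rabs_Ropp.
apply Rlt_le_trans with (eps / 2 + eps / 2); [|lra].
apply Rplus_lt_compat; [exact H1|exact H2].
Qed.

Lemma prim_continuous (f : W -> R) (x : W) : Cinf f -> continuous (prim f) x.
Proof.
intros H. destruct x as [y s].
(* For s' within 1 of s the interval between 0 and s' lies in [-b, b]. There the tube lemma keeps
   the integrands within eps/(2b) of each other, which costs eps/2; the other half pays for moving
   the upper limit at fixed y. *)
set (b := Rabs s + 1).
apply (proj2 (filterlim_locally (prim f) (prim f (y, s)))). intros eps.
assert (Hb : 0 < b) by (unfold b; pose proof (Rabs_pos s); lra).
assert (He : 0 < eps / (2 * b)).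
{ apply Rdiv_lt_0_compat; [apply cond_pos|lra]. }
assert (Hc : continuous (fun s => RInt (fun z => f (y, z)) 0 s) s).
{ apply (ex_derive_continuous (V := R_NormedModule)).
  eexists. apply (is_derive_RInt (V := R_NormedModule) (fun z => f (y, z)) _ 0 s).
  - apply filter_forall. intros z. apply (RInt_correct (V := R_CompleteNormedModule)).
    now apply ex_RInt_slice.
  - now apply continuous_slice. }
destruct (tube f y (- b) b (mkposreal _ He) H) as [d Hd].
destruct (proj1 (filterlim_locally _ _) Hc (pos_div_2 eps)) as [d2 Hd2].
assert (Hm : 0 < Rmin d (Rmin d2 1)).
{ pose proof (cond_pos d). pose proof (cond_pos d2).
  repeat apply Rmin_glb_lt; lra. }
exists (mkposreal _ Hm). intros [y' s'] [Hy Hs]. simpl in Hy, Hs.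
assert (Hs1 : ball s d2 s').
{ eapply ball_le; [|exact Hs]. eapply Rle_trans; [apply Rmin_r|apply Rmin_l]. }
assert (Hs2 : Rabs (s' - s) < 1).
{ eapply Rlt_le_trans; [exact Hs|]. eapply Rle_trans; [apply Rmin_r|apply Rmin_r]. }
assert (Hy1 : ball y d y').
{ eapply ball_le; [|exact Hy]. apply Rmin_l. }
assert (H2 : Rabs (RInt (fun z => f (y, z)) 0 s' - RInt (fun z => f (y, z)) 0 s) < eps / 2)
  by exact (Hd2 s' Hs1).
assert (Hs' : - b <= s' <= b).
{ unfold b. apply Rabs_def2 in Hs2. pose proof (Rle_abs s). pose proof (Rle_abs (- s)) as Q.
  rewrite Rabs_Ropp in Q. lra. }
assert (H1 : Rabs (RInt (fun z => f (y', z)) 0 s' - RInt (fun z => f (y, z)) 0 s') <= eps / 2).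
{ replace (RInt (fun z => f (y', z)) 0 s' - RInt (fun z => f (y, z)) 0 s')
    with (RInt (fun z => f (y', z) - f (y, z)) 0 s').
  2:{ apply (RInt_minus (V := R_CompleteNormedModule) (fun z => f (y', z)) (fun z => f (y, z)));
      now apply ex_RInt_slice. }
  assert (Hex : ex_RInt (fun z => f (y', z) - f (y, z)) 0 s').
  { apply (ex_RInt_minus (V := R_NormedModule) (fun z => f (y', z)) (fun z => f (y, z)));
      now apply ex_RInt_slice. }
  assert (Hbd : forall z, Rmin 0 s' <= z <= Rmax 0 s' -> Rabs (f (y', z) - f (y, z)) <= eps / (2 * b)).
  { intros z Hz. left. apply (Hd y' Hy1).
    revert Hz. unfold Rmin, Rmax. destruct (Rle_dec 0 s'); lra. }
  apply Rle_trans with (Rabs (s' - 0) * (eps / (2 * b))).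
  - apply abs_RInt_le_const_abs; assumption.
  - replace (eps / 2) with (b * (eps / (2 * b))) by (field; lra).
    apply Rmult_le_compat_r; [lra|]. rewrite Rminus_0_r. now apply Rabs_le. }
change (Rabs (RInt (fun z => f (y', z)) 0 s' - RInt (fun z => f (y, z)) 0 s) < eps).
replace (RInt (fun z => f (y', z)) 0 s' - RInt (fun z => f (y, z)) 0 s) with
  ((RInt (fun z => f (y', z)) 0 s' - RInt (fun z => f (y, z)) 0 s') +
   (RInt (fun z => f (y, z)) 0 s' - RInt (fun z => f (y, z)) 0 s)) by ring.
eapply Rle_lt_trans; [apply Rabs_triang|]. lra.
Qed.

Lemma Cinf_snd : Cinf (V := W) (fun p : W => snd p).
Proof.
apply Cinf_linear.
- intros [y s]. apply continuous_snd.
- reflexivity.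
Qed.

Lemma Cinf_prim (f : W -> R) : Cinf f -> Cinf (prim f).
Proof.
intros H k. revert f H. induction k as [|k IH]; intros f H.
- split; [intros x; now apply prim_continuous|exact I].
- apply (Ck_S k _ (fun (v : W) x => prim (dv (fst v) f) x + snd v * f x)).
  + intros x. now apply prim_continuous.
  + intros [v r] [y s]. now apply prim_dir.
  + intros v. apply Ck_plus.
    * apply IH. now apply Cinf_dv.
    * apply (Ck_mult (V := W) k (fun _ => snd v) f); [apply Ck_const|apply H].
Qed.

Lemma dv_zero (f : W -> R) : Cinf f -> dv zero f = fun _ => 0.
Proof.
intros H. apply functional_extensionality; intros [y s].
pose proof (is_derive_dv f y zero s 0 H) as D. rewrite line_0 in D.
etransitivity; [symmetry; exact (is_derive_unique _ _ _ D)|].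
rewrite (Derive_ext _ (fun _ => f (y, s))); [apply Derive_const|].
intros t. f_equal. apply (f_equal2 pair); [|reflexivity].
transitivity (plus y zero); [f_equal; apply (scal_zero_r (V := V) t)|apply plus_zero_r].
Qed.

Lemma ds_prim (f : W -> R) : Cinf f -> ds (prim f) = f.
Proof.
intros H. apply functional_extensionality; intros [y s].
unfold ds, ddir. etransitivity.
- apply is_derive_unique. now apply prim_dir.
- rewrite (dv_zero f H). unfold prim; simpl.
  rewrite RInt_const.
  change ((s - 0) * 0 + 1 * f (y, s) = f (y, s)). ring.
Qed.

End Families.

(** * Smooth functions on the line *)

Definition smooth (f : R -> R) : Prop := forall n s, ex_derive_n f n s.

Lemma smooth_ex f s : smooth f -> ex_derive f s.
Proof. intros H. exact (H 1%nat s). Qed.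

Lemma Derive_n_Derive f n s : Derive_n (Derive f) n s = Derive_n f (S n) s.
Proof. rewrite (Derive_n_comp f n 1). f_equal. lia. Qed.

Lemma smooth_Derive f : smooth f -> smooth (Derive f).
Proof.
intros H [|n] s; [exact I|].
apply ex_derive_ext with (Derive_n f (S n)).
- intros t. symmetry. apply Derive_n_Derive.
- exact (H (S (S n)) s).
Qed.

(** With its converse, this carries the closure properties of [Cinf] over to functions of s, so that
    they need not be proved a second time. *)
Lemma smooth_Cinf (f : R -> R) : smooth f -> Cinf (V := R_NormedModule) f.
Proof.
intros H k. apply (Ck_comp (V := R_NormedModule) k (Derive_n f) (fun x : R => x) 0).
- intros n r. apply Derive_correct. exact (H (S n) r).
- apply Cinf_linear; [intros x; apply continuous_id|reflexivity].
Qed.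

Lemma Cinf_smooth (f : R -> R) : Cinf (V := R_NormedModule) f -> smooth f.
Proof.
assert (D : forall f, Cinf (V := R_NormedModule) f -> forall t,
  is_derive f t (ddir (V := R_NormedModule) 1 f t)).
{ intros g H t.
  assert (E : forall t, plus (G := R_NormedModule) 0 (scal (V := R_NormedModule) t 1) = t).
  { intros z. change (0 + z * 1 = z). ring. }
  pose proof (is_derive_line (V := R_NormedModule) g 0 1 t H) as D.
  rewrite E in D. apply is_derive_ext with (2 := D). intros z. now rewrite E. }
intros H.
assert (E : forall n, exists g, Cinf (V := R_NormedModule) g /\ Derive_n f n = g).
{ induction n as [|n [g [Hg E]]].
  - exists f. split; auto.
  - exists (ddir (V := R_NormedModule) 1 g). split; [now apply (Cinf_ddir (V := R_NormedModule))|].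
    apply functional_extensionality; intros t. simpl. rewrite E.
    apply is_derive_unique. now apply D. }
intros [|n] s; [exact I|].
destruct (E n) as [g [Hg Eg]]. change (ex_derive (Derive_n f n) s).
rewrite Eg. eexists. now apply D.
Qed.

Lemma smooth_const a : smooth (fun _ => a).
Proof. apply Cinf_smooth. apply (Cinf_const (V := R_NormedModule)). Qed.

Lemma smooth_id : smooth (fun s => s).
Proof.
apply Cinf_smooth. apply Cinf_linear; [intros x; apply continuous_id|reflexivity].
Qed.

Lemma smooth_plus f g : smooth f -> smooth g -> smooth (fun s => f s + g s).
Proof.
intros Hf Hg. apply Cinf_smooth.
apply (Cinf_plus (V := R_NormedModule)); now apply smooth_Cinf.
Qed.

Lemma smooth_mult f g : smooth f -> smooth g -> smooth (fun s => f s * g s).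
Proof.
intros Hf Hg. apply Cinf_smooth.
apply (Cinf_mult (V := R_NormedModule)); now apply smooth_Cinf.
Qed.

Lemma smooth_opp f : smooth f -> smooth (fun s => - f s).
Proof.
intros Hf. apply Cinf_smooth.
apply (Cinf_opp (V := R_NormedModule)); now apply smooth_Cinf.
Qed.

Lemma smooth_minus f g : smooth f -> smooth g -> smooth (fun s => f s - g s).
Proof. intros Hf Hg. apply smooth_plus; auto. now apply smooth_opp. Qed.

Ltac smo :=
  lazymatch goal with
  | |- smooth (fun s => @?f s + @?g s) => apply (smooth_plus f g); smo
  | |- smooth (fun s => @?f s - @?g s) => apply (smooth_minus f g); smo
  | |- smooth (fun s => @?f s * @?g s) => apply (smooth_mult f g); smo
  | |- smooth (fun s => - @?f s) => apply (smooth_opp f); smo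
  | |- smooth (fun s => Derive ?f s) => apply (smooth_Derive f); smo
  | |- smooth (Derive ?f) => apply (smooth_Derive f); smo
  | |- smooth (fun s => ?f s) => change (smooth f); smo
  | |- smooth (fun s => s) => apply smooth_id
  | _ => first [assumption | exact (smooth_const _) | (eapply proj1; eassumption) | idtac]
  end.

Lemma Derive_plus_fun f g : smooth f -> smooth g ->
  Derive (fun s => f s + g s) = fun s => Derive f s + Derive g s.
Proof.
intros Hf Hg. apply functional_extensionality; intros s.
apply Derive_plus; now apply smooth_ex.
Qed.

Lemma Derive_minus_fun f g : smooth f -> smooth g ->
  Derive (fun s => f s - g s) = fun s => Derive f s - Derive g s.
Proof.
intros Hf Hg. apply functional_extensionality; intros s.
apply Derive_minus; now apply smooth_ex.
Qed.

Lemma Derive_mult_fun f g : smooth f -> smooth g ->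
  Derive (fun s => f s * g s) = fun s => Derive f s * g s + f s * Derive g s.
Proof.
intros Hf Hg. apply functional_extensionality; intros s.
apply Derive_mult; now apply smooth_ex.
Qed.

Lemma Derive_opp_fun f : Derive (fun s => - f s) = fun s => - Derive f s.
Proof. apply functional_extensionality; intros s. apply Derive_opp. Qed.

Lemma Derive_const_fun a : Derive (fun _ => a) = fun _ => 0.
Proof. apply functional_extensionality; intros s. apply Derive_const. Qed.

(** Reduces derivatives of polynomial expressions to iterated derivatives of their atoms, after
    which a differential identity is left to [ring] or [field]. *)
Ltac dfun :=
  repeat match goal with
  | |- context [Derive (fun s => @?f s + @?g s)] =>
      rewrite (Derive_plus_fun f g) by smo; cbv beta
  | |- context [Derive (fun s => @?f s - @?g s)] =>
      rewrite (Derive_minus_fun f g) by smo; cbv beta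
  | |- context [Derive (fun s => @?f s * @?g s)] =>
      rewrite (Derive_mult_fun f g) by smo; cbv beta
  | |- context [Derive (fun s => - @?f s)] => rewrite (Derive_opp_fun f); cbv beta
  | |- context [Derive (fun s => Derive ?f s)] =>
      change (Derive (fun s => Derive f s)) with (Derive (Derive f))
  | |- context [Derive (fun s => ?f s)] =>
      is_var f; change (Derive (fun s => f s)) with (Derive f)
  | |- context [Derive (fun s => ?a)] => rewrite (Derive_const_fun a); cbv beta
  end.

(** * Loops *)

Lemma Derive_periodic f T : (forall s, f (s + T) = f s) ->
  (forall s, ex_derive f s) -> forall s, Derive f (s + T) = Derive f s.
Proof.
intros Hp He s. symmetry. rewrite <- (Derive_ext (fun s => f (s + T)) f s) by exact Hp.
rewrite (Derive_comp f (fun s => s + T)); [|apply He|auto_derive; auto].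
replace (Derive (fun x : R => x + T) s) with 1; [ring|].
symmetry. apply is_derive_unique. auto_derive; auto.
Qed.

Lemma loop_Derive f : loop f -> loop (Derive f).
Proof.
intros [H Hp]. split; [now apply smooth_Derive|].
apply Derive_periodic; auto. intros s. now apply smooth_ex.
Qed.

Lemma loop_const a : loop (fun _ => a).
Proof. split; [apply smooth_const|auto]. Qed.

Lemma loop_plus f g : loop f -> loop g -> loop (fun s => f s + g s).
Proof.
intros [Hf Pf] [Hg Pg]. split; [now apply smooth_plus|].
intros s. now rewrite Pf, Pg.
Qed.

Lemma loop_minus f g : loop f -> loop g -> loop (fun s => f s - g s).
Proof.
intros [Hf Pf] [Hg Pg]. split; [now apply smooth_minus|].
intros s. now rewrite Pf, Pg.
Qed.

Lemma loop_mult f g : loop f -> loop g -> loop (fun s => f s * g s).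
Proof.
intros [Hf Pf] [Hg Pg]. split; [now apply smooth_mult|].
intros s. now rewrite Pf, Pg.
Qed.

Lemma loop_opp f : loop f -> loop (fun s => - f s).
Proof.
intros [Hf Pf]. split; [now apply smooth_opp|]. intros s. now rewrite Pf.
Qed.

Ltac lo :=
  lazymatch goal with
  | |- loop (fun s => @?f s + @?g s) => apply (loop_plus f g); lo
  | |- loop (fun s => @?f s - @?g s) => apply (loop_minus f g); lo
  | |- loop (fun s => @?f s * @?g s) => apply (loop_mult f g); lo
  | |- loop (fun s => - @?f s) => apply (loop_opp f); lo
  | |- loop (fun s => Derive ?f s) => apply (loop_Derive f); lo
  | |- loop (Derive ?f) => apply (loop_Derive f); lo
  | |- loop (fun s => ?f s) => change (loop f); lo
  | _ => first [assumption | exact (loop_const _) | idtac]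
  end.

Lemma loop_ex_RInt f a b : loop f -> ex_RInt f a b.
Proof.
intros [H _]. apply (ex_RInt_continuous (V := R_CompleteNormedModule)). intros z _.
apply (ex_derive_continuous (V := R_NormedModule)). now apply smooth_ex.
Qed.

Lemma integral_ext f g : (forall s, f s = g s) -> integral_S1 f = integral_S1 g.
Proof. intros H. apply RInt_ext. intros; apply H. Qed.

Lemma integral_plus f g : loop f -> loop g ->
  integral_S1 (fun s => f s + g s) = integral_S1 f + integral_S1 g.
Proof. intros Hf Hg. apply (RInt_plus (V := R_CompleteNormedModule)); now apply loop_ex_RInt. Qed.

Lemma integral_minus f g : loop f -> loop g ->
  integral_S1 (fun s => f s - g s) = integral_S1 f - integral_S1 g.
Proof. intros Hf Hg. apply (RInt_minus (V := R_CompleteNormedModule)); now apply loop_ex_RInt. Qed.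

Lemma integral_scal a f : loop f ->
  integral_S1 (fun s => a * f s) = a * integral_S1 f.
Proof. intros Hf. apply (RInt_scal (V := R_CompleteNormedModule)); now apply loop_ex_RInt. Qed.

Lemma integral_opp f : loop f -> integral_S1 (fun s => - f s) = - integral_S1 f.
Proof. intros Hf. apply (RInt_opp (V := R_CompleteNormedModule)); now apply loop_ex_RInt. Qed.

Lemma integral_0 : integral_S1 (fun _ => 0) = 0.
Proof.
unfold integral_S1. rewrite RInt_const. apply Rmult_0_r.
Qed.

Lemma RInt_Derive_smooth f a b : smooth f -> RInt (Derive f) a b = f b - f a.
Proof.
intros H. apply RInt_Derive.
- intros s _. now apply smooth_ex.
- intros s _. apply (ex_derive_continuous (V := R_NormedModule)).
  apply smooth_ex. now apply smooth_Derive.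
Qed.

Lemma integral_Derive f : loop f -> integral_S1 (Derive f) = 0.
Proof.
intros [H Hp]. unfold integral_S1. rewrite RInt_Derive_smooth by exact H.
rewrite <- (Hp 0). rewrite Rplus_0_l. ring.
Qed.

Lemma integral_parts f g : loop f -> loop g ->
  integral_S1 (fun s => f s * Derive g s) = - integral_S1 (fun s => Derive f s * g s).
Proof.
intros Hf Hg.
assert (E := integral_Derive (fun s => f s * g s) ltac:(lo)).
rewrite (Derive_mult_fun f g) in E by (eapply proj1; eassumption).
rewrite integral_plus in E by lo. lra.
Qed.

(** The increment of f over a period has derivative 0, since [Derive f] is periodic, and its value
    at 0 is the integral of [Derive f]. This is the step by which a tower closes up. *)
Lemma loop_primitive f : smooth f -> loop (Derive f) -> integral_S1 (Derive f) = 0 -> loop f.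
Proof.
intros Hf Hd Hi. split; [exact Hf|]. intros s.
assert (D : forall t, is_derive (fun t => f (t + 2 * PI) - f t) t 0).
{ intros t. evar_last.
  - apply (is_derive_minus (K := R_AbsRing) (V := R_NormedModule)).
    + apply (is_derive_comp (K := R_AbsRing) (V := R_NormedModule) f (fun t => t + 2 * PI)).
      * apply Derive_correct. now apply smooth_ex.
      * instantiate (1 := 1). auto_derive; auto.
    + apply Derive_correct. now apply smooth_ex.
  - change (1 * Derive f (t + 2 * PI) + - Derive f t = 0).
    rewrite (proj2 Hd). ring. }
assert (H0 : f (0 + 2 * PI) - f 0 = 0).
{ unfold integral_S1 in Hi. rewrite RInt_Derive_smooth in Hi by exact Hf.
  rewrite Rplus_0_l. exact Hi. }
destruct (Rtotal_order 0 s) as [Hs|[<-|Hs]].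
- assert (E := eq_is_derive (V := R_NormedModule) (fun t => f (t + 2 * PI) - f t) 0 s
    (fun t _ => D t) Hs). simpl in E. lra.
- lra.
- assert (E := eq_is_derive (V := R_NormedModule) (fun t => f (t + 2 * PI) - f t) s 0
    (fun t _ => D t) Hs). simpl in E. lra.
Qed.

Lemma Derive_eq_const f g : smooth f -> smooth g -> Derive f = Derive g ->
  exists c, f = fun s => g s + c.
Proof.
intros Hf Hg E. exists (f 0 - g 0). apply functional_extensionality; intros s.
assert (Q : RInt (Derive f) 0 s = RInt (Derive g) 0 s) by now rewrite E.
rewrite !RInt_Derive_smooth in Q by assumption. lra.
Qed.

(** * The second Hamiltonian operator of KdV *)

(* [Pop k f] is Omega f_s for the primitive f of f_s. *)
Definition Pop (k f : R -> R) : R -> R :=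
  fun s => 1 / 2 * Derive (Derive (Derive f)) s + 2 * k s * Derive f s + Derive k s * f s.

(** The commutator of the vector fields f d/ds and g d/ds. *)
Definition bracket (f g : R -> R) : R -> R := fun s => f s * Derive g s - Derive f s * g s.

(* Lie derivative of the quadratic differential w ds^2 along the vector field f d/ds. *)
Definition lie2 (f w : R -> R) : R -> R := fun s => f s * Derive w s + 2 * Derive f s * w s.

Lemma loop_Pop k f : loop k -> loop f -> loop (Pop k f).
Proof. intros Hk Hf. unfold Pop. lo. Qed.

Lemma smooth_Pop k f : smooth k -> smooth f -> smooth (Pop k f).
Proof. intros Hk Hf. unfold Pop. smo. Qed.

Lemma loop_bracket f g : loop f -> loop g -> loop (bracket f g).
Proof. intros Hf Hg. unfold bracket. lo. Qed.

Lemma Pop_skew k f g : loop k -> loop f -> loop g ->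
  integral_S1 (fun s => f s * Pop k g s) = - integral_S1 (fun s => Pop k f s * g s).
Proof.
intros Hk Hf Hg.
assert (Lf := loop_Pop k f Hk Hf). assert (Lg := loop_Pop k g Hk Hg).
assert (E : integral_S1 (fun s => f s * Pop k g s) + integral_S1 (fun s => Pop k f s * g s) = 0);
  [|lra].
rewrite <- integral_plus by lo.
(* F is the bilinear concomitant of P: its derivative is f P g + (P f) g, the terms with k combining
   to 2 (k f g)_s. *)
set (F := fun s => 1 / 2 * (f s * Derive (Derive g) s - Derive f s * Derive g s
   + Derive (Derive f) s * g s) + 2 * (k s * (f s * g s))).
assert (LF : loop F) by (unfold F; lo).
rewrite <- (integral_Derive F LF). apply integral_ext. intros s.
unfold F, Pop. destruct Hk, Hf, Hg. dfun. field.
Qed.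

Lemma Pop_plus k f g : smooth f -> smooth g ->
  Pop k (fun s => f s + g s) = fun s => Pop k f s + Pop k g s.
Proof.
intros Hf Hg. apply functional_extensionality; intros s. unfold Pop. dfun. ring.
Qed.

Lemma Pop_scal k a f : smooth f -> Pop k (fun s => a * f s) = fun s => a * Pop k f s.
Proof.
intros Hf. apply functional_extensionality; intros s. unfold Pop. dfun. ring.
Qed.

(** The cocycle property of P. Indeed P f = f_sss / 2 + [lie2 f k]: the first term is half the
    Gelfand-Fuchs cocycle, the second the coboundary of the quadratic differential k ds^2. *)
Lemma Pop_bracket k f g s : smooth k -> smooth f -> smooth g ->
  Pop k (bracket f g) s = lie2 f (Pop k g) s - lie2 g (Pop k f) s.
Proof.
intros Hk Hf Hg. unfold Pop, bracket, lie2. dfun. field.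
Qed.

(** The cocycle property of D, which is the coboundary of the constant quadratic differential 1/2:
    [lie2 f] sends it to f_s. *)
Lemma Derive_bracket f g s : smooth f -> smooth g ->
  Derive (bracket f g) s = lie2 f (Derive g) s - lie2 g (Derive f) s.
Proof. intros Hf Hg. unfold bracket, lie2. dfun. ring. Qed.

(** The pairing of quadratic differentials with vector fields is invariant; the two integrands add
    up to the derivative of w f g. *)
Lemma integral_lie2 f g w : loop f -> loop g -> loop w ->
  integral_S1 (fun s => lie2 f w s * g s) = - integral_S1 (fun s => w s * bracket f g s).
Proof.
intros Hf Hg Hw.
assert (L1 : loop (lie2 f w)) by (unfold lie2; lo).
assert (L2 := loop_bracket f g Hf Hg).
assert (E : integral_S1 (fun s => lie2 f w s * g s) + integral_S1 (fun s => w s * bracket f g s) = 0);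
  [|lra].
rewrite <- integral_plus by lo.
rewrite <- (integral_Derive (fun s => w s * (f s * g s)) ltac:(lo)).
apply integral_ext. intros s. unfold lie2, bracket. destruct Hf, Hg, Hw. dfun. ring.
Qed.

(** A skew-symmetric 1-cocycle yields a 2-cocycle on vector fields: move P from h onto [f, g],
    expand by [Pop_bracket], and transfer each Lie derivative to h by [integral_lie2]. *)
Lemma Pop_cocycle k f g h : loop k -> loop f -> loop g -> loop h ->
  integral_S1 (fun s => Pop k f s * bracket g h s) +
  integral_S1 (fun s => Pop k g s * bracket h f s) +
  integral_S1 (fun s => Pop k h s * bracket f g s) = 0.
Proof.
intros Hk Hf Hg Hh.
assert (Lf := loop_Pop k f Hk Hf). assert (Lg := loop_Pop k g Hk Hg).
assert (Lh := loop_Pop k h Hk Hh). assert (Lb := loop_bracket f g Hf Hg).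
assert (E := Pop_skew k h (bracket f g) Hk Hh Lb).
assert (E1 := integral_lie2 f h (Pop k g) Hf Hh Lg).
assert (E2 := integral_lie2 g h (Pop k f) Hg Hh Lf).
assert (L1 : loop (lie2 f (Pop k g))) by (unfold lie2; lo).
assert (L2 : loop (lie2 g (Pop k f))) by (unfold lie2; lo).
assert (E3 : integral_S1 (fun s => h s * Pop k (bracket f g) s) =
  integral_S1 (fun s => lie2 f (Pop k g) s * h s) - integral_S1 (fun s => lie2 g (Pop k f) s * h s)).
{ rewrite <- integral_minus by lo. apply integral_ext. intros s.
  destruct Hk, Hf, Hg. rewrite Pop_bracket by assumption. ring. }
assert (E4 : integral_S1 (fun s => Pop k g s * bracket h f s) =
  - integral_S1 (fun s => Pop k g s * bracket f h s)).
{ assert (L3 := loop_bracket f h Hf Hh).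
  rewrite <- integral_opp by lo. apply integral_ext. intros s. unfold bracket. ring. }
lra.
Qed.

(** * Recursion towers *)

(** The constants of the primitives are left free, so that the same notion covers the normalized
    towers, the arbitrary choices in [Omega_tower] and the gradients. *)
Definition is_tower (k : R -> R) (n : nat) (A : nat -> R -> R) : Prop :=
  (forall i, (i <= n)%nat -> loop (A i)) /\
  (forall i, (i < n)%nat -> Derive (A (S i)) = Pop k (A i)).

Lemma is_tower_le k n n' A : (n' <= n)%nat -> is_tower k n A -> is_tower k n' A.
Proof. intros H [H1 H2]. split; intros i Hi; [apply H1|apply H2]; lia. Qed.

(** One step: P passes from B_(j+1) to A_i and becomes D A_(i+1); then D passes back to B_(j+1) and
    becomes P B_j. Only the tower A has to reach index i + j. *)
Lemma tower_shift k nA nB A B i j : loop k -> is_tower k nA A -> is_tower k nB B ->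
  (i + j <= nA)%nat -> (j <= nB)%nat ->
  integral_S1 (fun s => A i s * Pop k (B j) s) =
  integral_S1 (fun s => A (i + j)%nat s * Pop k (B 0%nat) s).
Proof.
intros Hk HA HB. revert i. induction j as [|j IH]; intros i Hi Hj.
- now rewrite Nat.add_0_r.
- replace (i + S j)%nat with (S i + j)%nat by lia.
  rewrite <- IH by lia.
  rewrite Pop_skew; [|exact Hk|apply HA; lia|apply HB; lia].
  rewrite <- (proj2 HA i) by lia. rewrite <- (proj2 HB j) by lia.
  rewrite integral_parts; [reflexivity|apply HA; lia|apply HB; lia].
Qed.

(** * Curves *)

Section Curve.
Context (g : curve) (Mg : M g).
Let x := xc g.
Let y := yc g.
Let k := curvature g.

Lemma M_loop_x : loop x. Proof. apply Mg. Qed.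
Lemma M_loop_y : loop y. Proof. apply Mg. Qed.

Lemma M_det s : x s * Derive y s - y s * Derive x s = 1.
Proof. apply Mg. Qed.

Lemma curvature_eq : k = fun s => Derive x s * Derive (Derive y) s - Derive y s * Derive (Derive x) s.
Proof. reflexivity. Qed.

Lemma M_loop_k : loop k.
Proof.
rewrite curvature_eq. pose proof M_loop_x. pose proof M_loop_y. lo.
Qed.

Lemma M_xss : Derive (Derive x) = fun s => - k s * x s.
Proof.
apply functional_extensionality; intros s. exact (f_equal fst (curvatureE g s Mg)).
Qed.

Lemma M_yss : Derive (Derive y) = fun s => - k s * y s.
Proof.
apply functional_extensionality; intros s. exact (f_equal snd (curvatureE g s Mg)).
Qed.

Lemma det_tvec a s : det (g s) (tvec g a s) = a s.
Proof.
pose proof (M_det s) as D. unfold x, y, xc, yc in D.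
unfold det, tvec, comb, D_n; simpl.
transitivity (a s * (xc g s * Derive (yc g) s - yc g s * Derive (xc g) s)).
- unfold xc, yc; simpl. ring.
- unfold xc, yc; rewrite D. ring.
Qed.

Lemma tvec_inj a b : (forall s, tvec g a s = tvec g b s) -> a = b.
Proof.
intros H. apply functional_extensionality; intros s.
rewrite <- (det_tvec a), <- (det_tvec b). now rewrite H.
Qed.

(** One coordinate of [tvec]. The following lemmas assume only Hill's equation z_ss = - k z, and so
    treat both coordinates at once. *)
Definition tcomp (a z : R -> R) : R -> R := fun s => - (1 / 2) * Derive a s * z s + a s * Derive z s.

Lemma det_tvec_tvec a b s :
  det (tvec g a s) (tvec g b s) = - (1 / 2) * Derive a s * b s + 1 / 2 * (a s * Derive b s).
Proof.
pose proof (M_det s) as D.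
change (tcomp a x s * tcomp b y s - tcomp a y s * tcomp b x s =
  - (1 / 2) * Derive a s * b s + 1 / 2 * (a s * Derive b s)).
(* Multiplication by det(g, g_s) = 1 makes both sides quadratic in the coordinates of g and g_s;
   what remains is a polynomial identity. The same device returns in the next determinant
   computations. *)
replace (- (1 / 2) * Derive a s * b s + 1 / 2 * (a s * Derive b s)) with
 ((- (1 / 2) * Derive a s * b s + 1 / 2 * (a s * Derive b s)) *
  (x s * Derive y s - y s * Derive x s)) by (rewrite D; ring).
unfold tcomp. field.
Qed.

Lemma tcomp_s (a z : R -> R) : smooth a -> smooth z -> Derive (Derive z) = (fun s => - k s * z s) ->
  Derive (tcomp a z) = fun s => (- (1 / 2) * Derive (Derive a) s - k s * a s) * z s
    + 1 / 2 * Derive a s * Derive z s.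
Proof.
intros Ha Hz E. unfold tcomp. dfun. rewrite E.
apply functional_extensionality; intros s. field.
Qed.

Lemma tcomp_ss (a z : R -> R) : smooth a -> smooth z -> Derive (Derive z) = (fun s => - k s * z s) ->
  Derive (Derive (tcomp a z)) = fun s =>
  (- (1 / 2) * Derive (Derive (Derive a)) s - Derive k s * a s - 3 / 2 * k s * Derive a s) * z s
    - k s * a s * Derive z s.
Proof.
intros Ha Hz E. rewrite tcomp_s by assumption. pose proof (proj1 M_loop_k) as Hk.
dfun. rewrite E. apply functional_extensionality; intros s. field.
Qed.

(** Hill's operator D^2 + k annihilates g and sends [tvec g b] to - (P b) g, whose determinant with
    [tvec g a] is a P b. This identifies the determinant form of omega_1 with its form by P. *)
Lemma det_Hill (a b : R -> R) s : smooth b ->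
  det (tvec g a s) (comb 1 (D_n 2 (tvec g b) s) (k s) (tvec g b s)) = a s * Pop k b s.
Proof.
intros Hb. pose proof (M_det s) as D. pose proof (proj1 M_loop_x). pose proof (proj1 M_loop_y).
unfold det, comb, D_n. cbn [fst snd].
change (fst (tvec g a s)) with (tcomp a x s). change (snd (tvec g a s)) with (tcomp a y s).
change (fst (tvec g b s)) with (tcomp b x s). change (snd (tvec g b s)) with (tcomp b y s).
change (Derive_n (xc (tvec g b)) 2) with (Derive (Derive (tcomp b x))).
change (Derive_n (yc (tvec g b)) 2) with (Derive (Derive (tcomp b y))).
rewrite !tcomp_ss by (assumption || exact M_xss || exact M_yss).
replace (a s * Pop k b s) with
  (a s * Pop k b s * (x s * Derive y s - y s * Derive x s)) by (rewrite D; ring).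
unfold tcomp, Pop. field.
Qed.

(** The left side is the linearization of k = det(g_s, g_ss) in the direction [tvec g a]; this is
    the source of k_t = P alpha. *)
Lemma curvature_variation (a : R -> R) s : smooth a ->
  Derive (tcomp a x) s * Derive (Derive y) s + Derive x s * Derive (Derive (tcomp a y)) s
  - (Derive (tcomp a y) s * Derive (Derive x) s + Derive y s * Derive (Derive (tcomp a x)) s)
  = Pop k a s.
Proof.
intros Ha. pose proof (M_det s) as D. pose proof (proj1 M_loop_x). pose proof (proj1 M_loop_y).
rewrite !tcomp_ss by (assumption || exact M_xss || exact M_yss).
rewrite !tcomp_s by (assumption || exact M_xss || exact M_yss).
rewrite M_xss, M_yss.
replace (Pop k a s) with
  (Pop k a s * (x s * Derive y s - y s * Derive x s)) by (rewrite D; ring).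
unfold Pop. field.
Qed.

End Curve.

(** * Differential polynomials along a loop *)

Lemma loop_Derive_n k n : loop k -> loop (Derive_n k n).
Proof. intros H. induction n as [|n IH]; [exact H|]. simpl. lo. Qed.

Lemma loop_deval p k : loop k -> loop (fun s => deval p (jet k s)).
Proof.
intros H. induction p as [c|j|p IHp q IHq|p IHp q IHq]; simpl.
- apply loop_const.
- now apply (loop_Derive_n k j).
- lo.
- lo.
Qed.

Lemma Derive_deval p k : loop k ->
  Derive (fun s => deval p (jet k s)) = fun s => deval (dtot p) (jet k s).
Proof.
intros H. induction p as [c|j|p IHp q IHq|p IHp q IHq]; simpl.
- apply Derive_const_fun.
- reflexivity.
- rewrite Derive_plus_fun; [|exact (proj1 (loop_deval p k H))|exact (proj1 (loop_deval q k H))]. now rewrite IHp, IHq.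
- rewrite Derive_mult_fun; [|exact (proj1 (loop_deval p k H))|exact (proj1 (loop_deval q k H))]. now rewrite IHp, IHq.
Qed.

Lemma deval_iter_dtot p k n : loop k ->
  (fun s => deval (Nat.iter n dtot p) (jet k s)) = Derive_n (fun s => deval p (jet k s)) n.
Proof.
intros H. induction n as [|n IH]; [reflexivity|].
cbn [Nat.iter nat_rect]. rewrite <- Derive_deval by exact H.
change (Derive (fun s => deval (Nat.iter n dtot p) (jet k s)) =
  Derive (Derive_n (fun s => deval p (jet k s)) n)).
now rewrite IH.
Qed.

(** The left integrand is the linearization of p along w. Integrating by parts j times in the j-th
    term frees w and produces the signs of the Euler operator. *)
Lemma integral_euler N p k w : loop k -> loop w ->
  integral_S1 (fun s => sum_f_R0 (fun j => deval (dpart j p) (jet k s) * Derive_n w j s) N) =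
  integral_S1 (fun s => deval (euler_upto N p) (jet k s) * w s).
Proof.
intros Hk Hw. induction N as [|N IH].
- reflexivity.
- assert (L : forall N, loop (fun s => sum_f_R0 (fun j => deval (dpart j p) (jet k s) * Derive_n w j s) N)).
  { assert (L0 : forall j, loop (fun s => deval (dpart j p) (jet k s) * Derive_n w j s)).
    { intros j. apply loop_mult; [now apply loop_deval|now apply loop_Derive_n]. }
    intros n. induction n as [|n IHn]; [apply (L0 0%nat)|].
    simpl. exact (loop_plus _ _ IHn (L0 (S n))). }
  assert (Lq := loop_deval (dpart (S N) p) k Hk).
  set (q := fun s => deval (dpart (S N) p) (jet k s)) in *.
  assert (Hparts : forall j, integral_S1 (fun s => q s * Derive_n w j s) =
     (-1) ^ j * integral_S1 (fun s => Derive_n q j s * w s)).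
  { assert (G : forall j q, loop q -> integral_S1 (fun s => q s * Derive_n w j s) =
     (-1) ^ j * integral_S1 (fun s => Derive_n q j s * w s)); [|intros j; now apply G].
    induction j as [|j IHj]; intros r Hr; [simpl; ring|].
    change (Derive_n w (S j)) with (Derive (Derive_n w j)).
    rewrite integral_parts; [|exact Hr|now apply loop_Derive_n].
    rewrite (IHj (Derive r)) by now apply loop_Derive.
    rewrite (integral_ext (fun s => Derive_n (Derive r) j s * w s) (fun s => Derive_n r (S j) s * w s)).
    - simpl. ring.
    - intros s. now rewrite Derive_n_Derive. }
  cbn [sum_f_R0]. rewrite integral_plus.
  2: apply L.
  2: apply loop_mult; [exact Lq|now apply loop_Derive_n].
  rewrite IH, Hparts, <- integral_scal.
  2: apply loop_mult; [now apply loop_Derive_n|exact Hw].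
  rewrite <- integral_plus.
  2: { pose proof (loop_deval (euler_upto N p) k Hk). lo. }
  2: { pose proof (loop_Derive_n q (S N) Lq). lo. }
  apply integral_ext. intros s.
  change (deval (euler_upto (S N) p) (jet k s)) with
    (deval (euler_upto N p) (jet k s) +
     (-1) ^ S N * deval (Nat.iter (S N) dtot (dpart (S N) p)) (jet k s)).
  rewrite (f_equal (fun F => F s) (deval_iter_dtot (dpart (S N) p) k (S N) Hk)).
  fold q. ring.
Qed.

(** * The gradients of the KdV Hamiltonians *)

Section Gradients.
Context (h : nat -> dpoly) (Hh : kdv_densities h).

(** That a polynomial primitive exists at all is read off from the densities: the variational
    derivative of h_(n+2) is one, and subtracting its value at 0 normalizes it. Only with this does
    the choice in [dinv] mean anything. *)
Lemma dinv_kdv n : is_dprim (kdv n) (dinv (kdv n)).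
Proof.
unfold dinv. apply epsilon_spec.
set (q := vder (h (n + 2))).
exists (dadd q (dconst (- deval q (fun _ => 0)))). split.
- intros u. simpl. rewrite Rplus_0_r. apply (proj2 (proj2 Hh) n u).
- simpl. ring.
Qed.

(* The gradient of H_(i+1), with the constants of the higher gradients removed. *)
Definition grad (k : R -> R) (i : nat) : R -> R :=
  match i with
  | O => fun _ => 1
  | S n => fun s => deval (dinv (kdv n)) (jet k s)
  end.

Lemma loop_grad k i : loop k -> loop (grad k i).
Proof.
intros Hk. destruct i; simpl; [apply loop_const|now apply loop_deval].
Qed.

Lemma Derive_grad k n : loop k ->
  Derive (grad k (S n)) = fun s => deval (kdv n) (jet k s).
Proof.
intros Hk. simpl. rewrite Derive_deval by exact Hk.
apply functional_extensionality; intros s. apply (proj1 (dinv_kdv n)).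
Qed.

(** P applied to the constant 1 gives k_s, the start of the hierarchy, and the recursion in [kdv] is
    P applied to the preceding gradient. Being differential polynomials, all entries are periodic,
    whence no bound on n. *)
Lemma grad_tower k n : loop k -> is_tower k n (grad k).
Proof.
intros Hk. split; intros i Hi; [now apply loop_grad|].
rewrite Derive_grad by exact Hk. destruct i as [|i].
- apply functional_extensionality; intros s. unfold Pop. simpl.
  rewrite !Derive_const_fun. change (Derive (fun x : R => k x) s) with (Derive k s). ring.
- unfold Pop. rewrite Derive_grad by exact Hk.
  rewrite !Derive_deval by exact Hk.
  apply functional_extensionality; intros s.
  change (deval (kdv (S i)) (jet k s)) with
    (1 / 2 * deval (dtot (dtot (kdv i))) (jet k s) + 2 * (k s * deval (kdv i) (jet k s))
     + Derive k s * grad k (S i) s).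
  ring.
Qed.

Lemma vder_grad k n : loop k ->
  exists c, (fun s => deval (vder (h (n + 2)%nat)) (jet k s)) = fun s => grad k (S n) s + c.
Proof.
intros Hk. apply Derive_eq_const.
- exact (proj1 (loop_deval _ k Hk)).
- exact (proj1 (loop_grad k _ Hk)).
- rewrite Derive_grad, Derive_deval by exact Hk.
  apply functional_extensionality; intros s. apply (proj2 (proj2 Hh) n).
Qed.

End Gradients.

(** * Families of curves *)

Section Slices.
Context {V : NormedModule R_AbsRing}.
Local Notation W := (prod_NormedModule R_AbsRing V R_NormedModule).

Definition slice (f : W -> R) (y : V) : R -> R := fun s => f (y, s).

Lemma Derive_slice (f : W -> R) (y : V) : Cinf f -> Derive (slice f y) = slice (ds f) y.
Proof.
intros H. apply functional_extensionality; intros s. apply is_derive_unique.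
now apply is_derive_ds.
Qed.

Lemma dv_plus (v : V) (f g : W -> R) : Cinf f -> Cinf g ->
  dv v (fun p : W => f p + g p) = fun p : W => dv v f p + dv v g p.
Proof. apply (ddir_plus (V := W)). Qed.

Lemma dv_minus (v : V) (f g : W -> R) : Cinf f -> Cinf g ->
  dv v (fun p : W => f p - g p) = fun p : W => dv v f p - dv v g p.
Proof. apply (ddir_minus (V := W)). Qed.

Lemma dv_mult (v : V) (f g : W -> R) : Cinf f -> Cinf g ->
  dv v (fun p : W => f p * g p) = fun p : W => dv v f p * g p + f p * dv v g p.
Proof. apply (ddir_mult (V := W)). Qed.

Lemma dv_const (v : V) (a : R) : dv v (fun _ : W => a) = fun _ => 0.
Proof. apply (ddir_const (V := W)). Qed.

Lemma ds_minus (f g : W -> R) : Cinf f -> Cinf g ->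
  ds (fun p : W => f p - g p) = fun p : W => ds f p - ds g p.
Proof. apply (ddir_minus (V := W)). Qed.

Lemma ds_mult (f g : W -> R) : Cinf f -> Cinf g ->
  ds (fun p : W => f p * g p) = fun p : W => ds f p * g p + f p * ds g p.
Proof. apply (ddir_mult (V := W)). Qed.

Lemma Cinf_iter_ds (f : W -> R) n : Cinf f -> Cinf (Nat.iter n ds f).
Proof. intros H. induction n as [|n IH]; [exact H|]. now apply Cinf_ds. Qed.

Lemma Derive_n_slice (f : W -> R) (y : V) n : Cinf f ->
  Derive_n (slice f y) n = slice (Nat.iter n ds f) y.
Proof.
intros H. induction n as [|n IH]; [reflexivity|].
change (Derive (Derive_n (slice f y) n) = slice (ds (Nat.iter n ds f)) y).
rewrite IH. apply Derive_slice. now apply Cinf_iter_ds.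
Qed.

Lemma smooth_slice (f : W -> R) (y : V) : Cinf f -> smooth (slice f y).
Proof.
intros H [|n] s; [exact I|].
change (ex_derive (Derive_n (slice f y) n) s). rewrite Derive_n_slice by exact H.
eexists. apply is_derive_ds. now apply Cinf_iter_ds.
Qed.

Lemma is_derive_dv0 (f : W -> R) (y v : V) (s : R) : Cinf f ->
  is_derive (fun t : R => f (plus y (scal t v), s)) 0 (dv v f (y, s)).
Proof.
intros H. pose proof (is_derive_dv f y v s 0 H) as D. rewrite line_0 in D. exact D.
Qed.

Lemma is_derive_integral0 (f : W -> R) (y v : V) : Cinf f ->
  is_derive (fun t : R => integral_S1 (slice f (plus y (scal t v)))) 0
    (integral_S1 (slice (dv v f) y)).
Proof.
intros H. pose proof (is_derive_integral f y v 0 (2 * PI) 0 H) as D.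
rewrite line_0 in D. exact D.
Qed.

Lemma dv_at (f : W -> R) (y v : V) (s : R) : Cinf f ->
  dv v f (y, s) = Derive (fun t : R => f (plus y (scal t v), s)) 0.
Proof. intros H. symmetry. apply is_derive_unique. now apply is_derive_dv0. Qed.

Lemma loop_slice_dv (f : W -> R) (y v : V) : Cinf f ->
  (forall y, loop (slice f y)) -> loop (slice (dv v f) y).
Proof.
intros H Hl. split; [apply smooth_slice; now apply Cinf_dv|].
intros s. unfold slice. rewrite !dv_at by exact H.
apply Derive_ext. intros t. apply (proj2 (Hl (plus y (scal t v)))).
Qed.

Lemma ds_dv (f : W -> R) (v : V) : Cinf f -> ds (dv v f) = dv v (ds f).
Proof. apply (ddir_comm (V := W)). Qed.

Lemma dv_dv (f : W -> R) (u v : V) : Cinf f -> dv u (dv v f) = dv v (dv u f).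
Proof. apply (ddir_comm (V := W)). Qed.

Lemma iter_ds_dv (f : W -> R) (v : V) n : Cinf f ->
  dv v (Nat.iter n ds f) = Nat.iter n ds (dv v f).
Proof.
intros H. induction n as [|n IH]; [reflexivity|].
change (dv v (ds (Nat.iter n ds f)) = ds (Nat.iter n ds (dv v f))).
rewrite <- IH. symmetry. apply ds_dv. now apply Cinf_iter_ds.
Qed.

End Slices.

Section CurveFamily.
Context {V : NormedModule R_AbsRing} (G : V -> curve) (PG : plot M G).
Local Notation W := (prod_NormedModule R_AbsRing V R_NormedModule).

Definition famX : W -> R := fun p : W => xc (G (fst p)) (snd p).
Definition famY : W -> R := fun p : W => yc (G (fst p)) (snd p).
Definition famK : W -> R := fun p : W => curvature (G (fst p)) (snd p).
(* The function alpha of the tangent vector in the direction v; see [velocity_tvec]. *)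
Definition famA (v : V) : W -> R := fun p : W => famX p * dv v famY p - famY p * dv v famX p.

Lemma Cinf_X : Cinf famX. Proof. apply PG. Qed.
Lemma Cinf_Y : Cinf famY. Proof. apply PG. Qed.
Lemma family_M y : M (G y). Proof. apply PG. Qed.

Lemma Cinf_A v : Cinf (famA v).
Proof.
pose proof Cinf_X. pose proof Cinf_Y.
apply (Cinf_minus (V := W)); apply (Cinf_mult (V := W)); auto; now apply Cinf_dv.
Qed.

Lemma famK_eq : famK = fun p : W => ds famX p * ds (ds famY) p - ds famY p * ds (ds famX) p.
Proof.
apply functional_extensionality; intros [y s].
pose proof Cinf_X as HX. pose proof Cinf_Y as HY.
change (Derive (slice famX y) s * Derive (Derive (slice famY y)) s
  - Derive (slice famY y) s * Derive (Derive (slice famX y)) s =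
  ds famX (y, s) * ds (ds famY) (y, s) - ds famY (y, s) * ds (ds famX) (y, s)).
rewrite !Derive_slice; auto; now apply Cinf_ds.
Qed.

Lemma Cinf_K : Cinf famK.
Proof.
pose proof Cinf_X. pose proof Cinf_Y. rewrite famK_eq.
apply (Cinf_minus (V := W)); apply (Cinf_mult (V := W)); repeat apply Cinf_ds; auto.
Qed.

Lemma fam_det : (fun p : W => famX p * ds famY p - famY p * ds famX p) = fun _ => 1.
Proof.
apply functional_extensionality; intros [y s].
pose proof Cinf_X as HX. pose proof Cinf_Y as HY.
rewrite <- (M_det (G y) (family_M y) s).
change (slice famX y s * slice (ds famY) y s - slice famY y s * slice (ds famX) y s =
  slice famX y s * Derive (slice famY y) s - slice famY y s * Derive (slice famX y) s).
now rewrite !Derive_slice.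
Qed.

Lemma fam_det_dv v :
  (fun p : W => dv v famX p * ds famY p - famY p * ds (dv v famX) p) =
  (fun p : W => dv v famY p * ds famX p - famX p * ds (dv v famY) p).
Proof.
pose proof Cinf_X as HX. pose proof Cinf_Y as HY.
pose proof (Cinf_ds _ HX) as HdX. pose proof (Cinf_ds _ HY) as HdY.
assert (E : dv v (fun p : W => famX p * ds famY p - famY p * ds famX p) = fun _ => 0).
{ rewrite fam_det. apply dv_const. }
rewrite dv_minus, !dv_mult in E; auto; try (now apply (Cinf_mult (V := W))).
rewrite !ds_dv by assumption.
apply functional_extensionality; intros p. apply (f_equal (fun f => f p)) in E.
cbv beta in E. lra.
Qed.

(** Differentiating det(g, g_s) = 1 along v makes the two cross terms of alpha_s equal. So det(g_s,
    velocity) is alpha_s / 2, which forces the coefficient - alpha_s / 2 of g in the velocity. *)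
Lemma ds_famA v : ds (famA v) = fun p : W => 2 * (ds famX p * dv v famY p - ds famY p * dv v famX p).
Proof.
pose proof Cinf_X as HX. pose proof Cinf_Y as HY.
pose proof (Cinf_dv v _ HX) as HdX. pose proof (Cinf_dv v _ HY) as HdY.
unfold famA.
rewrite ds_minus, !ds_mult; auto; try (now apply (Cinf_mult (V := W))).
apply functional_extensionality; intros p.
assert (E := f_equal (fun f => f p) (fam_det_dv v)). cbv beta in E. lra.
Qed.

(** Cramer's rule in the frame g, g_s of determinant 1; alpha is the coefficient of g_s and
    [ds_famA] gives that of g. *)
Lemma slice_dvX v y : slice (dv v famX) y = tcomp (slice (famA v) y) (xc (G y)).
Proof.
pose proof Cinf_X as HX. pose proof Cinf_Y as HY.
apply functional_extensionality; intros s. unfold tcomp.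
rewrite Derive_slice by apply Cinf_A. rewrite ds_famA.
change (xc (G y)) with (slice famX y). rewrite Derive_slice by exact HX.
assert (E := f_equal (fun f => f (y, s)) fam_det). cbv beta in E.
unfold slice, famA.
transitivity (dv v famX (y, s) * (famX (y, s) * ds famY (y, s) - famY (y, s) * ds famX (y, s))).
- rewrite E. ring.
- field.
Qed.

Lemma slice_dvY v y : slice (dv v famY) y = tcomp (slice (famA v) y) (yc (G y)).
Proof.
pose proof Cinf_X as HX. pose proof Cinf_Y as HY.
apply functional_extensionality; intros s. unfold tcomp.
rewrite Derive_slice by apply Cinf_A. rewrite ds_famA.
change (yc (G y)) with (slice famY y). rewrite Derive_slice by exact HY.
assert (E := f_equal (fun f => f (y, s)) fam_det). cbv beta in E.
unfold slice, famA.
transitivity (dv v famY (y, s) * (famX (y, s) * ds famY (y, s) - famY (y, s) * ds famX (y, s))).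
- rewrite E. ring.
- field.
Qed.

Lemma velocity_dv y v s : velocity G y v s = (dv v famX (y, s), dv v famY (y, s)).
Proof.
pose proof Cinf_X as HX. pose proof Cinf_Y as HY.
unfold velocity. now rewrite !dv_at.
Qed.

Lemma velocity_tvec y v s : velocity G y v s = tvec (G y) (slice (famA v) y) s.
Proof.
rewrite velocity_dv. change (dv v famX (y, s)) with (slice (dv v famX) y s).
change (dv v famY (y, s)) with (slice (dv v famY) y s).
now rewrite slice_dvX, slice_dvY.
Qed.

Lemma loop_slice_X y : loop (slice famX y). Proof. apply (M_loop_x _ (family_M y)). Qed.
Lemma loop_slice_Y y : loop (slice famY y). Proof. apply (M_loop_y _ (family_M y)). Qed.
Lemma loop_slice_K y : loop (slice famK y). Proof. apply (M_loop_k _ (family_M y)). Qed.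

Lemma loop_slice_A v y : loop (slice (famA v) y).
Proof.
pose proof Cinf_X as HX. pose proof Cinf_Y as HY.
pose proof (loop_slice_dv famX y v HX loop_slice_X).
pose proof (loop_slice_dv famY y v HY loop_slice_Y).
pose proof (loop_slice_X y). pose proof (loop_slice_Y y).
exact (loop_minus _ _ (loop_mult _ _ H1 H0) (loop_mult _ _ H2 H)).
Qed.

Lemma slice_dvK v y : slice (dv v famK) y = Pop (curvature (G y)) (slice (famA v) y).
Proof.
pose proof Cinf_X as HX. pose proof Cinf_Y as HY.
pose proof (Cinf_ds _ HX) as HdX. pose proof (Cinf_ds _ HY) as HdY.
pose proof (Cinf_ds _ HdX) as HddX. pose proof (Cinf_ds _ HdY) as HddY.
pose proof (Cinf_dv v _ HX) as HvX. pose proof (Cinf_dv v _ HY) as HvY.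
apply functional_extensionality; intros s.
rewrite <- (curvature_variation (G y) (family_M y)) by exact (proj1 (loop_slice_A v y)).
rewrite <- slice_dvX, <- slice_dvY.
change (xc (G y)) with (slice famX y). change (yc (G y)) with (slice famY y).
rewrite !Derive_slice by (assumption || now apply Cinf_ds).
rewrite famK_eq. unfold slice.
rewrite dv_minus, !dv_mult; auto; try (now apply (Cinf_mult (V := W))).
rewrite !ds_dv by (assumption || now apply Cinf_ds).
ring.
Qed.

Definition famJ (p : dpoly) : W -> R := fun q => deval p (fun j => Nat.iter j ds famK q).

Lemma famJ_jet p y : slice (famJ p) y = fun s => deval p (jet (curvature (G y)) s).
Proof.
apply functional_extensionality; intros s. unfold slice, famJ. f_equal.
apply functional_extensionality; intros j.
change (slice (Nat.iter j ds famK) y s = Derive_n (slice famK y) j s).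
now rewrite Derive_n_slice by apply Cinf_K.
Qed.

Lemma Cinf_J p : Cinf (famJ p).
Proof.
induction p as [c|j|p IHp q IHq|p IHp q IHq].
- exact (Cinf_const (V := W) c).
- apply (Cinf_iter_ds famK j), Cinf_K.
- exact (Cinf_plus (V := W) _ _ IHp IHq).
- exact (Cinf_mult (V := W) _ _ IHp IHq).
Qed.

Lemma sum_single (N j : nat) (F : nat -> R) : (j <= N)%nat ->
  sum_f_R0 (fun i => (if Nat.eqb j i then 1 else 0) * F i) N = F j.
Proof.
intros Hj. induction N as [|N IH].
- replace j with 0%nat by lia. simpl. ring.
- simpl. destruct (Nat.eqb_spec j (S N)) as [->|Hne].
  + rewrite (sum_eq _ (fun _ => 0)).
    * rewrite sum_cte. simpl. ring.
    * intros i Hi. destruct (Nat.eqb_spec (S N) i); [lia|ring].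
  + rewrite IH by lia. ring.
Qed.

(** The chain rule along the jet. N is an arbitrary bound of the order, so that both halves of a sum
    or product can use the same N. *)
Lemma dv_famJ p v N : (dord p <= N)%nat ->
  dv v (famJ p) = fun q => sum_f_R0 (fun j => famJ (dpart j p) q * Nat.iter j ds (dv v famK) q) N.
Proof.
intros HN. induction p as [c|j|p IHp q IHq|p IHp q IHq]; simpl in HN.
- transitivity (fun _ : W => 0); [exact (dv_const v c)|].
  apply functional_extensionality; intros r. unfold famJ; simpl.
  rewrite (sum_eq _ (fun _ => 0)); [rewrite sum_cte; ring|]. intros; ring.
- change (famJ (dvar j)) with (Nat.iter j ds famK). rewrite iter_ds_dv by apply Cinf_K.
  apply functional_extensionality; intros r. unfold famJ; simpl.
  symmetry. apply (sum_single N j (fun j => Nat.iter j ds (dv v famK) r)). lia.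
- transitivity (fun r => dv v (famJ p) r + dv v (famJ q) r).
  { exact (dv_plus v _ _ (Cinf_J p) (Cinf_J q)). }
  rewrite IHp, IHq by lia.
  apply functional_extensionality; intros r. rewrite <- sum_plus.
  apply sum_eq. intros i _. unfold famJ; simpl. ring.
- transitivity (fun r => dv v (famJ p) r * famJ q r + famJ p r * dv v (famJ q) r).
  { exact (dv_mult v _ _ (Cinf_J p) (Cinf_J q)). }
  rewrite IHp, IHq by lia.
  apply functional_extensionality; intros r.
  rewrite Rmult_comm, !scal_sum, <- sum_plus.
  apply sum_eq. intros i _. unfold famJ; simpl. ring.
Qed.

(** Linearize the density, commute the s-derivatives with the variation of k, replace the latter by
    P alpha, and integrate by parts into the Euler operator. *)
Lemma first_variation p y v :
  is_derive (fun t : R => Ham p (G (plus y (scal t v)))) 0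
    (integral_S1 (fun s => deval (vder p) (jet (curvature (G y)) s) *
       Pop (curvature (G y)) (slice (famA v) y) s)).
Proof.
set (k := curvature (G y)).
assert (Hk : loop k) by apply loop_slice_K.
evar_last.
- apply is_derive_ext with (fun t : R => integral_S1 (slice (famJ p) (plus y (scal t v)))).
  + intros t. now rewrite famJ_jet.
  + apply is_derive_integral0, Cinf_J.
- unfold vder. rewrite <- integral_euler.
  + apply integral_ext. intros s. rewrite (dv_famJ p v (dord p)) by lia.
    unfold slice at 1. apply sum_eq. intros j _.
    change (slice (famJ (dpart j p)) y s * slice (Nat.iter j ds (dv v famK)) y s =
      deval (dpart j p) (jet k s) * Derive_n (Pop k (slice (famA v) y)) j s).
    rewrite famJ_jet, <- Derive_n_slice by (apply Cinf_dv, Cinf_K).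
    now rewrite slice_dvK.
  + exact Hk.
  + apply loop_Pop; [exact Hk|apply loop_slice_A].
Qed.

End CurveFamily.

(** * Tangent vectors are velocities *)

Lemma loop_period_nat f (n : nat) s : loop f -> f (s + INR n * (2 * PI)) = f s.
Proof.
intros [_ Hp]. induction n as [|n IH].
- simpl. f_equal. ring.
- rewrite S_INR. transitivity (f (s + INR n * (2 * PI) + 2 * PI)); [f_equal; ring|].
  now rewrite Hp.
Qed.

Lemma loop_reduce f s : loop f -> exists s', 0 <= s' <= 2 * PI /\ f s' = f s.
Proof.
intros Hf. assert (HP : 0 < 2 * PI) by (pose proof PI_RGT_0; lra).
destruct (archimed (s / (2 * PI))) as [H1 H2].
set (z := (up (s / (2 * PI)) - 1)%Z).
assert (Hz : IZR z <= s / (2 * PI) < IZR z + 1).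
{ unfold z. rewrite minus_IZR. lra. }
assert (Hs : s = s / (2 * PI) * (2 * PI)) by (field; lra).
exists (s - IZR z * (2 * PI)). split.
- split; rewrite Hs at 1.
  + assert (0 <= (s / (2 * PI) - IZR z) * (2 * PI)) by (apply Rmult_le_pos; lra). lra.
  + assert ((s / (2 * PI) - IZR z) * (2 * PI) <= 1 * (2 * PI)) by (apply Rmult_le_compat_r; lra). lra.
- destruct (Z.le_gt_cases 0 z) as [Hp|Hn].
  + rewrite <- (loop_period_nat f (Z.to_nat z) (s - IZR z * (2 * PI)) Hf).
    rewrite INR_IZR_INZ, Z2Nat.id by exact Hp. f_equal. ring.
  + rewrite <- (loop_period_nat f (Z.to_nat (- z)) s Hf).
    rewrite INR_IZR_INZ, Z2Nat.id, opp_IZR by lia. f_equal. ring.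
Qed.

Lemma loop_bounded f : loop f -> exists C, 0 < C /\ forall s, f s * f s <= C.
Proof.
intros Hf.
destruct (continuity_ab_maj (fun s => f s * f s) 0 (2 * PI)) as [m [Hm _]].
- pose proof PI_RGT_0; lra.
- intros s _. apply continuity_pt_filterlim.
  apply (ex_derive_continuous (V := R_NormedModule) (fun s => f s * f s)).
  apply smooth_ex. exact (proj1 (loop_mult f f Hf Hf)).
- exists (f m * f m + 1). split; [nra|]. intros s.
  destruct (loop_reduce f s Hf) as [s' [Hs' <-]]. specialize (Hm s' Hs'). lra.
Qed.

Lemma Cinf_comp {V : NormedModule R_AbsRing} (phi : R -> R) (f : V -> R) :
  smooth phi -> Cinf f -> Cinf (fun x => phi (f x)).
Proof.
intros Hp Hf k. apply (Ck_comp k (Derive_n phi) f 0); [|apply Hf].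
intros n r. apply Derive_correct. exact (Hp (S n) r).
Qed.

Section Variation.
Context (g : curve) (Mg : M g) (a : R -> R) (Ha : loop a).
Local Notation W := (prod_NormedModule R_AbsRing R_NormedModule R_NormedModule).

(* Reparametrize by s + psi(t) a(s) and rescale to restore det(g, g_s) = 1; psi is
   bounded so that this is a diffeomorphism for all t. *)
Lemma variation_exists : exists G, variation g (tvec g a) G.
Proof.
destruct (loop_bounded (Derive a) (loop_Derive a Ha)) as [C [HC0 HC]].
(* Here psi(0) = 0, psi'(0) = 1 and psi^2 < 1 / C, while a_s^2 <= C; hence 1 + psi(t) a_s > 0 for
   every real t. *)
set (psi := fun t : R => t * / sqrt (1 + C * (t * t))).
assert (HP1 : forall t, 0 < 1 + C * (t * t)) by (intros t; nra).
assert (HP2 : forall t s, 0 < 1 + psi t * Derive a s).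
{ intros t s. unfold psi. pose proof (sqrt_lt_R0 _ (HP1 t)) as Hr.
  pose proof (sqrt_sqrt _ (Rlt_le _ _ (HP1 t))) as Hr2.
  set (r := sqrt (1 + C * (t * t))) in *. specialize (HC s). set (b := Derive a s) in *.
  replace (1 + t * / r * b) with ((r + t * b) * / r) by (field; lra).
  apply Rmult_lt_0_compat; [|now apply Rinv_0_lt_compat].
  destruct (Rlt_le_dec 0 (r + t * b)) as [|Hn]; [assumption|exfalso].
  assert (r * r <= (t * b) * (t * b)) by nra.
  assert ((t * t) * (b * b) <= (t * t) * C) by (apply Rmult_le_compat_l; nra). nra. }
assert (Cfst : Cinf (V := W) (fun p => fst p)).
{ apply Cinf_linear; [|reflexivity]. intros [t s]. apply continuous_fst. }
assert (Csnd : Cinf (V := W) (fun p => snd p)) by apply Cinf_snd.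
assert (Cpsi : Cinf (V := W) (fun p => psi (fst p))).
{ unfold psi. apply (Cinf_mult (V := W)); [exact Cfst|]. intros j.
  apply (Ck_invsqrt (V := W)); [intros p; apply HP1|].
  apply (Ck_plus (V := W)); [apply Ck_const|].
  apply (Ck_mult (V := W)); [apply Ck_const|].
  apply (Ck_mult (V := W)); apply Cfst. }
assert (Cphi : Cinf (V := W) (fun p => snd p + psi (fst p) * a (snd p))).
{ apply (Cinf_plus (V := W)); [exact Csnd|].
  apply (Cinf_mult (V := W)); [exact Cpsi|].
  apply (Cinf_comp (V := W) a (fun p => snd p)); [exact (proj1 Ha)|exact Csnd]. }
assert (Cw : Cinf (V := W) (fun p => / sqrt (1 + psi (fst p) * Derive a (snd p)))).
{ intros j. apply (Ck_invsqrt (V := W)); [intros p; apply HP2|].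
  apply (Ck_plus (V := W)); [apply Ck_const|].
  apply (Ck_mult (V := W)); [apply Cpsi|].
  apply (Cinf_comp (V := W) (Derive a) (fun p => snd p)); [exact (proj1 (loop_Derive a Ha))|exact Csnd]. }
(* With phi = s + psi a the weight is phi_s^(-1/2). Its derivative drops out of det(g, g_s), and
   phi_s times the squared weight is 1; at t = 0 it contributes the term - a_s z / 2 of the
   velocity. *)
set (fam := fun (z : R -> R) (t s : R) =>
  z (s + psi t * a s) * / sqrt (1 + psi t * Derive a s)).
assert (Cfam : forall z, loop z -> Cinf (V := W) (fun p => fam z (fst p) (snd p))).
{ intros z Hz. apply (Cinf_mult (V := W)); [|exact Cw].
  apply (Cinf_comp (V := W) z _ (proj1 Hz) Cphi). }
assert (Lfam : forall z t, loop z -> loop (fam z t)).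
{ intros z t Hz. split.
  - exact (smooth_slice (fun p : W => fam z (fst p) (snd p)) t (Cfam z Hz)).
  - intros s. unfold fam. rewrite (proj2 (loop_Derive a Ha)), (proj2 Ha).
    replace (s + 2 * PI + psi t * a s) with (s + psi t * a s + 2 * PI) by ring.
    now rewrite (proj2 Hz). }
pose proof (M_loop_x g Mg) as Lx. pose proof (M_loop_y g Mg) as Ly.
assert (Dfam : forall z t s, loop z -> is_derive (fam z t) s
  (Derive z (s + psi t * a s) * (1 + psi t * Derive a s) * / sqrt (1 + psi t * Derive a s)
   + z (s + psi t * a s) * Derive (fun s => / sqrt (1 + psi t * Derive a s)) s)).
{ intros z t s Hz.
  apply (is_derive_Rmult (fun s => z (s + psi t * a s)) (fun s => / sqrt (1 + psi t * Derive a s))).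
  - evar_last.
    + apply (is_derive_comp (K := R_AbsRing) (V := R_NormedModule) z (fun s => s + psi t * a s)).
      * apply Derive_correct, smooth_ex. exact (proj1 Hz).
      * instantiate (1 := 1 + psi t * Derive a s).
        auto_derive; [exact (smooth_ex a s (proj1 Ha))|]. change (Derive (fun x : R => a x) s) with (Derive a s). ring.
    + change ((1 + psi t * Derive a s) * Derive z (s + psi t * a s) =
        Derive z (s + psi t * a s) * (1 + psi t * Derive a s)). ring.
  - apply Derive_correct.
    apply ex_derive_ext with (fun s => (fun r => / sqrt r) (1 + psi t * Derive a s)); [reflexivity|].
    apply (ex_derive_comp (K := R_AbsRing) (V := R_NormedModule) (fun r => / sqrt r)).
    + eexists. apply is_derive_invsqrt, HP2.
    + apply smooth_ex. pose proof (proj1 (loop_Derive a Ha)). smo. }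
assert (Dfam0 : forall z s, loop z -> is_derive (fun t => fam z t s) 0 (tcomp a z s)).
{ intros z s Hz. unfold fam, tcomp.
  assert (P0 : psi 0 = 0) by (unfold psi; ring).
  assert (Dpsi : is_derive psi 0 1).
  { unfold psi. evar_last.
    - apply (is_derive_Rmult (fun t => t) (fun t => / sqrt (1 + C * (t * t)))); [apply is_derive_id|].
      apply Derive_correct.
      apply ex_derive_ext with (fun s => (fun r => / sqrt r) (1 + C * (s * s))); [reflexivity|].
      apply (ex_derive_comp (K := R_AbsRing) (V := R_NormedModule) (fun r => / sqrt r)).
      + eexists. apply is_derive_invsqrt, HP1.
      + auto_derive; auto.
    - replace (1 + C * (0 * 0)) with 1 by ring. rewrite sqrt_1.
      change (1 * / 1 + 0 * Derive (fun t : R => / sqrt (1 + C * (t * t))) 0 = 1). field. }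
  evar_last.
  - apply (is_derive_Rmult (fun t => z (s + psi t * a s)) (fun t => / sqrt (1 + psi t * Derive a s))).
    + apply (is_derive_comp (K := R_AbsRing) (V := R_NormedModule) z (fun t => s + psi t * a s)).
      * apply Derive_correct, smooth_ex. exact (proj1 Hz).
      * instantiate (1 := a s). evar_last.
        { apply (is_derive_plus (K := R_AbsRing) (V := R_NormedModule) (fun _ => s) (fun t => psi t * a s)).
          - apply (is_derive_const (K := R_AbsRing) (V := R_NormedModule)).
          - apply (is_derive_Rmult psi (fun _ => _)); [exact Dpsi|apply (is_derive_const (K := R_AbsRing) (V := R_NormedModule))]. }
        change (0 + (1 * a s + psi 0 * 0) = a s). ring.
    + apply (is_derive_comp (K := R_AbsRing) (V := R_NormedModule) (fun r => / sqrt r)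
        (fun t => 1 + psi t * Derive a s)).
      * apply is_derive_invsqrt, HP2.
      * instantiate (1 := Derive a s). evar_last.
        { apply (is_derive_plus (K := R_AbsRing) (V := R_NormedModule) (fun _ => 1) (fun t => psi t * Derive a s)).
          - apply (is_derive_const (K := R_AbsRing) (V := R_NormedModule)).
          - apply (is_derive_Rmult psi (fun _ => _)); [exact Dpsi|apply (is_derive_const (K := R_AbsRing) (V := R_NormedModule))]. }
        change (0 + (1 * Derive a s + psi 0 * 0) = Derive a s). ring.
  - cbv beta. rewrite P0. replace (s + 0 * a s) with s by ring.
    replace (1 + 0 * Derive a s) with 1 by ring. rewrite sqrt_1.
    change (a s * Derive z s * / 1 + z s * (Derive a s * (- (1 / 2) * (/ 1 * (/ 1 * / 1)))) =
      - (1 / 2) * Derive a s * z s + a s * Derive z s). field. }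
exists (fun t s => (fam (xc g) t s, fam (yc g) t s)).
split; [|split].
- split; [exact (Cfam _ Lx)|split; [exact (Cfam _ Ly)|]]. intros t.
  assert (Hdet : forall s, fam (xc g) t s * Derive (fam (yc g) t) s -
     fam (yc g) t s * Derive (fam (xc g) t) s = 1).
  { intros s. rewrite (is_derive_unique _ _ _ (Dfam _ t s Lx)).
    rewrite (is_derive_unique _ _ _ (Dfam _ t s Ly)).
    pose proof (M_det g Mg (s + psi t * a s)) as D. unfold fam.
    pose proof (sqrt_lt_R0 _ (HP2 t s)) as Hr.
    pose proof (sqrt_sqrt _ (Rlt_le _ _ (HP2 t s))) as Hr2.
    set (w := sqrt (1 + psi t * Derive a s)) in *. rewrite <- Hr2.
    set (q := s + psi t * a s) in *.
    transitivity (xc g q * Derive (yc g) q - yc g q * Derive (xc g) q); [|exact D].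
    field. lra. }
  split; [exact (Lfam _ t Lx)|split; [exact (Lfam _ t Ly)|split]].
  + intros s E. specialize (Hdet s).
    assert (E1 := f_equal fst E). assert (E2 := f_equal snd E). simpl in E1, E2.
    rewrite E1, E2 in Hdet. lra.
  + exact Hdet.
- intros s. unfold fam. assert (P0 : psi 0 = 0) by (unfold psi; ring).
  rewrite P0. replace (s + 0 * a s) with s by ring.
  replace (1 + 0 * Derive a s) with 1 by ring. rewrite sqrt_1, Rinv_1, !Rmult_1_r.
  unfold xc, yc. now destruct (g s).
- intros s. unfold velocity.
  assert (E : forall z, loop z ->
    Derive (fun t : R => fam z (plus (G := R_NormedModule) 0 (scal (V := R_NormedModule) t 1)) s) 0 = tcomp a z s).
  { intros z Hz. rewrite <- (is_derive_unique _ _ _ (Dfam0 z s Hz)).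
    apply Derive_ext. intros t. f_equal. change (0 + t * 1 = t). ring. }
  exact (f_equal2 pair (E _ Lx) (E _ Ly)).
Qed.

End Variation.

(** * The forms omega_k *)

Definition primitive (f : R -> R) : R -> R := fun s => RInt f 0 s.

Lemma is_derive_primitive f s : smooth f -> is_derive (primitive f) s (f s).
Proof.
intros H.
assert (Hc : forall z, continuous f z).
{ intros z. apply (ex_derive_continuous (V := R_NormedModule)). now apply smooth_ex. }
apply (is_derive_RInt (V := R_NormedModule) f _ 0 s); [|apply Hc].
apply filter_forall. intros z. apply (RInt_correct (V := R_CompleteNormedModule)).
apply (ex_RInt_continuous (V := R_CompleteNormedModule)). intros; apply Hc.
Qed.

Lemma Derive_primitive f : smooth f -> Derive (primitive f) = f.
Proof.
intros H. apply functional_extensionality; intros s. apply is_derive_unique.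
now apply is_derive_primitive.
Qed.

Lemma smooth_primitive f : smooth f -> smooth (primitive f).
Proof.
intros H [|[|n]] s; [exact I| |].
- eexists. now apply is_derive_primitive.
- change (ex_derive (Derive_n (primitive f) (S n)) s).
  apply ex_derive_ext with (Derive_n f n).
  + intros t. rewrite <- Derive_n_Derive. now rewrite Derive_primitive.
  + exact (H (S n) s).
Qed.

(** Defined on the line with every primitive vanishing at 0, whether or not it is periodic;
    periodicity is a separate assertion, made by [is_tower]. *)
Fixpoint tow (k a : R -> R) (i : nat) : R -> R :=
  match i with
  | O => a
  | S i => primitive (Pop k (tow k a i))
  end.

Lemma smooth_tow k a i : smooth k -> smooth a -> smooth (tow k a i).
Proof.
intros Hk Ha. induction i as [|i IH]; [exact Ha|].
now apply smooth_primitive, smooth_Pop.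
Qed.

Lemma Derive_tow k a i : smooth k -> smooth a -> Derive (tow k a (S i)) = Pop k (tow k a i).
Proof. intros Hk Ha. now apply Derive_primitive, smooth_Pop, smooth_tow. Qed.

Lemma is_tower_tow k m a : loop k -> loop a ->
  (forall i, (i <= m)%nat -> loop (tow k a i)) -> is_tower k m (tow k a).
Proof.
intros Hk Ha H. split; [exact H|]. intros i _. apply Derive_tow; [exact (proj1 Hk)|exact (proj1 Ha)].
Qed.

Lemma tow_comb k a a' r r' i : smooth k -> smooth a -> smooth a' ->
  tow k (fun s => r * a s + r' * a' s) i = fun s => r * tow k a i s + r' * tow k a' i s.
Proof.
intros Hk Ha Ha'. induction i as [|i IH]; [reflexivity|].
pose proof (smooth_tow k a i Hk Ha). pose proof (smooth_tow k a' i Hk Ha').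
simpl. rewrite IH. rewrite Pop_plus, !Pop_scal by smo.
apply functional_extensionality; intros s. unfold primitive.
assert (He : forall f, smooth f -> ex_RInt f 0 s).
{ intros f Hf. apply (ex_RInt_continuous (V := R_CompleteNormedModule)). intros z _.
  apply (ex_derive_continuous (V := R_NormedModule)). now apply smooth_ex. }
assert (S1 : smooth (Pop k (tow k a i))) by now apply smooth_Pop.
assert (S2 : smooth (Pop k (tow k a' i))) by now apply smooth_Pop.
etransitivity; [apply (RInt_plus (V := R_CompleteNormedModule)
   (fun s => r * Pop k (tow k a i) s) (fun s => r' * Pop k (tow k a' i) s)); apply He; smo|].
apply (f_equal2 Rplus); apply (RInt_scal (V := R_CompleteNormedModule)); now apply He.
Qed.

Lemma tower_linear k m a a' r r' : loop k -> loop a -> loop a' ->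
  is_tower k m (tow k a) -> is_tower k m (tow k a') ->
  is_tower k m (tow k (fun s => r * a s + r' * a' s)).
Proof.
intros Hk Ha Ha' H H'. apply is_tower_tow; [exact Hk|lo|]. intros i Hi.
rewrite tow_comb; [|exact (proj1 Hk)|exact (proj1 Ha)|exact (proj1 Ha')].
pose proof (proj1 H i Hi). pose proof (proj1 H' i Hi). lo.
Qed.

Section Forms.
Context (g : curve) (Mg : M g).
Let k := curvature g.
Let Hk : loop k := M_loop_k g Mg.

Lemma tow_shift m a B n : is_tower k m (tow k a) -> is_tower k n B -> (n <= m)%nat ->
  integral_S1 (fun s => a s * Pop k (B n) s) =
  integral_S1 (fun s => tow k a n s * Pop k (B 0%nat) s).
Proof. intros HA HB Hn. apply (tower_shift k m n (tow k a) B 0 n Hk HA HB); lia. Qed.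

(** For n >= 2, [tower_shift] moves all steps from the primitives F, however chosen, to the tower of
    a; of F only [F 0] = b is left, so the constants cannot matter. The case n = m + 1 is included
    because E_n = P F_(n-1) uses primitives up to index m only. *)
Lemma is_omega_iff m n a b l : loop a -> loop b ->
  is_tower k m (tow k a) -> is_tower k m (tow k b) -> (n <= m + 1)%nat ->
  is_omega n g (tvec g a) (tvec g b) l <->
  l = integral_S1 (fun s => a s * Derive (tow k b n) s).
Proof.
intros Ha Hb TA TB Hn.
pose proof (proj1 Hk) as Sk. pose proof (proj1 Ha) as Sa. pose proof (proj1 Hb) as Sb.
destruct n as [|[|n]].
- assert (E : integral_S1 (fun s => det (tvec g a s) (tvec g b s)) =
    integral_S1 (fun s => a s * Derive b s)).
  { rewrite (integral_ext _ (fun s => - (1 / 2) * (Derive a s * b s) + 1 / 2 * (a s * Derive b s))).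
    - rewrite integral_plus, !integral_scal by lo.
      rewrite integral_parts by assumption. lra.
    - intros s. rewrite det_tvec_tvec by assumption. ring. }
  simpl. now rewrite E.
- simpl is_omega. fold k. rewrite Derive_tow by assumption.
  rewrite (integral_ext _ (fun s => a s * Pop k b s)); [reflexivity|].
  intros s. now apply det_Hill.
- rewrite Derive_tow by assumption. split.
  + intros [a' [b' [E [F [_ [_ [Ea [Eb [[E0 [F0 HT]] ->]]]]]]]]].
    rewrite <- (tvec_inj g Mg a a' Ea). apply (tvec_inj g Mg) in Eb. subst b'.
    assert (EF : forall i, (i < S (S n))%nat -> Derive (F i) = E i).
    { intros i Hi. apply functional_extensionality. apply (HT i Hi). }
    assert (EP : forall i, (i < S (S n))%nat -> E (S i) = Pop k (F i)).
    { intros i Hi. apply functional_extensionality; intros s.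
      rewrite (proj2 (proj2 (HT i Hi)) s), <- EF by exact Hi. reflexivity. }
    assert (TF : is_tower k (S n) F).
    { split; [intros i Hi; apply HT; lia|]. intros i Hi. rewrite EF, EP by lia. reflexivity. }
    rewrite EP by lia.
    rewrite (tow_shift m a F (S n) TA TF ltac:(lia)).
    rewrite (tow_shift m a (tow k b) (S n) TA
      (is_tower_le k m (S n) _ ltac:(lia) TB) ltac:(lia)).
    replace (F 0%nat) with b; [reflexivity|].
    symmetry. apply functional_extensionality, F0.
  + intros ->. exists a, b, (fun i => Derive (tow k b i)), (tow k b).
    split; [exact Ha|split; [exact Hb|split; [reflexivity|split; [reflexivity|split]]]].
    * split; [reflexivity|split; [reflexivity|]]. intros i Hi.
      split; [apply TB; lia|split; [reflexivity|]].
      intros s. rewrite Derive_tow by assumption. reflexivity.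
    * now rewrite Derive_tow by assumption.
Qed.

Lemma omega_eq m n a b : loop a -> loop b ->
  is_tower k m (tow k a) -> is_tower k m (tow k b) -> (n <= m + 1)%nat ->
  omega n g (tvec g a) (tvec g b) = integral_S1 (fun s => a s * Derive (tow k b n) s).
Proof.
intros Ha Hb TA TB Hn.
apply (is_omega_iff m n a b); auto. unfold omega. apply epsilon_spec.
eexists. now apply (is_omega_iff m n a b).
Qed.

(** For n >= 1 all n - 1 recursion steps are shifted from a to b, after which the skew-symmetry of P
    concludes; n = 0 is the skew-symmetry of D. *)
Lemma omega_skew m n a b : loop a -> loop b ->
  is_tower k m (tow k a) -> is_tower k m (tow k b) -> (n <= m + 1)%nat ->
  integral_S1 (fun s => b s * Derive (tow k a n) s) =
  - integral_S1 (fun s => a s * Derive (tow k b n) s).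
Proof.
intros Ha Hb TA TB Hn.
pose proof (proj1 Hk) as Sk. pose proof (proj1 Ha) as Sa. pose proof (proj1 Hb) as Sb.
destruct n as [|n].
- simpl. rewrite integral_parts by assumption. f_equal. apply integral_ext. intros; ring.
- rewrite !Derive_tow by assumption.
  rewrite (tow_shift m b (tow k a) n TB
      (is_tower_le k m n _ ltac:(lia) TA) ltac:(lia)).
  assert (L : loop (tow k b n)) by (apply TB; lia).
  change (tow k a 0) with a. rewrite (Pop_skew k (tow k b n) a Hk L Ha). f_equal. apply integral_ext. intros s. simpl. ring.
Qed.

(** * Differentials of the Hamiltonians *)

Lemma variation_derive p a G : variation g (tvec g a) G -> loop a ->
  is_derive (fun t : R => Ham p (G t)) 0
    (integral_S1 (fun s => deval (vder p) (jet k s) * Pop k a s)).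
Proof.
intros [PG [G0 GV]] Ha.
assert (E0 : G 0 = g) by (apply functional_extensionality, G0).
pose proof (first_variation (V := R_NormedModule) G PG p 0 1) as D.
assert (EA : slice (famA G 1) 0 = a).
{ apply (tvec_inj g Mg). intros s. rewrite <- GV.
  rewrite (velocity_tvec (V := R_NormedModule) G PG). now rewrite E0. }
rewrite EA, E0 in D.
apply is_derive_ext with (2 := D). intros t. do 2 f_equal.
change (0 + t * 1 = t). ring.
Qed.

(** [variation_exists] provides the variation required by [is_dH]. All variations give the same
    derivative, because [tvec_inj] identifies their alpha at t = 0 with a. *)
Lemma is_dH_iff p a l : loop a ->
  is_dH (Ham p) g (tvec g a) l <->
  l = integral_S1 (fun s => deval (vder p) (jet k s) * Pop k a s).
Proof.
intros Ha. split.
- intros [[G HG] HD].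
  rewrite <- (is_derive_unique _ _ _ (HD G HG)).
  apply is_derive_unique. now apply variation_derive.
- intros ->. split; [now apply variation_exists|].
  intros G HG. now apply variation_derive.
Qed.

Context (h : nat -> dpoly) (Hh : kdv_densities h).

(** The variational derivative of h_(j+1) and [grad k j] differ by a constant, which a vanishing
    mean of P a makes harmless. For j = 0 both are 1 and no condition on a is called for. *)
Lemma is_dH_grad j a l : loop a -> j = 0%nat \/ integral_S1 (Pop k a) = 0 ->
  is_dH (Ham (h (S j))) g (tvec g a) l <-> l = integral_S1 (fun s => grad k j s * Pop k a s).
Proof.
intros Ha Hj. pose proof (loop_Pop k a Hk Ha) as LP.
destruct j as [|n].
(* [h 1] equals kappa only up to [dp_eq], while [vder] is computed on terms; the exchange is made
   inside [Ham], which depends on values alone. *)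
- replace (Ham (h 1%nat)) with (Ham (dvar 0)).
  + rewrite is_dH_iff by exact Ha.
    rewrite (integral_ext (fun s => deval (vder (dvar 0)) (jet k s) * Pop k a s)
      (fun s => grad k 0 s * Pop k a s)); [reflexivity|]. reflexivity.
  + apply functional_extensionality; intros g'. apply integral_ext. intros s.
    symmetry. apply (proj1 (proj2 Hh)).
- rewrite is_dH_iff by exact Ha.
  destruct (vder_grad h Hh k n Hk) as [c Ec]. replace (n + 2)%nat with (S (S n)) in Ec by lia.
  pose proof (loop_grad k (S n) Hk) as LG.
  assert (E : integral_S1 (fun s => deval (vder (h (S (S n)))) (jet k s) * Pop k a s) =
     integral_S1 (fun s => grad k (S n) s * Pop k a s)).
  { rewrite (integral_ext _ (fun s => grad k (S n) s * Pop k a s + c * Pop k a s)).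
    - rewrite integral_plus, integral_scal by lo. destruct Hj as [|Hj]; [discriminate|].
      rewrite Hj. ring.
    - intros s. rewrite (f_equal (fun f => f s) Ec). ring. }
  now rewrite E.
Qed.

Lemma TMC_tower m X : (1 <= m)%nat -> TMC h m g X ->
  exists a, loop a /\ X = tvec g a /\ is_tower k m (tow k a) /\ integral_S1 (Pop k a) = 0.
Proof.
intros Hm [[a [Ha EX]] HT]. apply functional_extensionality in EX. subst X.
pose proof (proj1 Hk) as Sk. pose proof (proj1 Ha) as Sa.
(* The constraint dH_1 = 0 is exploited first: the later ones become pairings with [grad] only once
   the mean of P a is known to vanish. *)
assert (H0 : integral_S1 (Pop k a) = 0).
{ rewrite (integral_ext _ (fun s => grad k 0 s * Pop k a s)).
  - symmetry. apply (is_dH_grad 0 a 0 Ha); [now left|]. apply HT. lia.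
  - intros s. simpl. ring. }
exists a. split; [exact Ha|split; [reflexivity|split; [|exact H0]]].
apply is_tower_tow; [exact Hk|exact Ha|].
intros i Hi. revert i Hi.
assert (HS : forall j, (j <= m)%nat -> forall i, (i <= j)%nat -> loop (tow k a i)).
{ induction j as [|j IH]; intros Hj i Hi.
  - replace i with 0%nat by lia. exact Ha.
  - destruct (Nat.eq_dec i (S j)) as [->|Hne]; [|apply IH; lia].
    assert (TA : is_tower k j (tow k a)).
    { apply is_tower_tow; [exact Hk|exact Ha|]. apply IH. lia. }
    apply loop_primitive.
    + now apply smooth_tow.
    + rewrite Derive_tow by assumption. apply loop_Pop; [exact Hk|apply TA; lia].
    + rewrite Derive_tow by assumption.
      (* The mean of P T_j is its pairing with [grad k 0] = 1; shifting the j steps to the gradients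
         turns it into the pairing of [grad k j] with P a, that is dH_(j+1). *)
      rewrite (integral_ext _ (fun s => grad k 0 s * Pop k (tow k a j) s)) by (intros; simpl; ring).
      rewrite (tower_shift k j j (grad k) (tow k a) 0 j Hk (grad_tower h Hh k j Hk) TA) by lia.
      symmetry. apply (is_dH_grad j a 0 Ha); [now right|]. apply HT. lia. }
intros i Hi. now apply (HS i).
Qed.

(** Involution of the Hamiltonians: shifting everything to one side leaves, up to sign, the mean of
    P [grad k (i + j)], which is the derivative of the next gradient. *)
Lemma grad_involution i j : integral_S1 (fun s => grad k i s * Pop k (grad k j) s) = 0.
Proof.
rewrite (tower_shift k (i + j) j (grad k) (grad k) i j Hk
  (grad_tower h Hh k _ Hk) (grad_tower h Hh k _ Hk)) by lia.
pose proof (loop_grad k (i + j) Hk) as L1. pose proof (loop_grad k 0 Hk) as L2.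
rewrite Pop_skew by assumption.
rewrite <- (proj2 (grad_tower h Hh k (S (i + j)) Hk) (i + j)%nat) by lia.
rewrite (integral_ext _ (Derive (grad k (S (i + j))))) by (intros; simpl; ring).
rewrite integral_Derive by (now apply loop_grad). ring.
Qed.

Lemma KdV_field_tvec n : (1 <= n)%nat -> KdV_field n g = tvec g (grad k n).
Proof.
intros Hn. destruct n as [|n]; [lia|].
apply functional_extensionality; intros s. unfold tvec.
rewrite (Derive_grad h Hh k n Hk). unfold KdV_field. replace (S n - 1)%nat with n by lia.
reflexivity.
Qed.

(** The alpha of X_n is itself a gradient, so tangency to all level sets is involution. *)
Lemma KdV_field_TMC n m : (1 <= n)%nat -> TMC h m g (KdV_field n g).
Proof.
intros Hn. rewrite KdV_field_tvec by exact Hn.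
pose proof (loop_grad k n Hk) as Ln.
split; [exists (grad k n); split; [exact Ln|reflexivity]|].
intros j Hj. destruct j as [|j]; [lia|].
apply is_dH_grad; [exact Ln| |].
- right. rewrite <- (grad_involution 0 n). apply integral_ext. intros; simpl; ring.
- now rewrite grad_involution.
Qed.

(** For r >= 1 the form is the pairing of [grad k n] with P T_(r-1)(b); shifting gives
    [grad k (n + r - 1)] against P b. Since [grad k j] belongs to H_(j+1), this is dH_(n+r). For r =
    0 one step is taken backwards, through D [grad k n] = P [grad k (n - 1)]. *)
Lemma KdV_hamiltonian n m r Y : (1 <= n)%nat -> (1 <= m)%nat -> (r <= m + 1)%nat ->
  TMC h m g Y -> is_dH (Ham (h (n + r)%nat)) g Y (omega r g (KdV_field n g) Y).
Proof.
intros Hn Hm Hr HY.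
assert (HX := KdV_field_TMC n m Hn).
destruct (TMC_tower m Y Hm HY) as [b [Hb [-> [TB IB]]]].
destruct (TMC_tower m _ Hm HX) as [a [Ha [EX [TA _]]]].
rewrite KdV_field_tvec in * by exact Hn.
assert (Ea : grad k n = a).
{ apply (tvec_inj g Mg). intros s. now rewrite EX. }
subst a.
pose proof (proj1 Hk) as Sk. pose proof (proj1 Ha) as Sa. pose proof (proj1 Hb) as Sb.
rewrite (omega_eq m) by assumption.
destruct n as [|n]; [lia|]. replace (S n + r)%nat with (S (n + r)) by lia.
apply is_dH_grad; [exact Hb|now right|].
destruct r as [|r].
- rewrite Nat.add_0_r. simpl tow.
  pose proof (loop_grad k n Hk) as L.
  rewrite (Pop_skew k _ _ Hk L Hb), integral_parts by assumption.
  now rewrite (proj2 (grad_tower h Hh k (S n) Hk) n) by lia.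
- rewrite Derive_tow by assumption.
  rewrite (tower_shift k (S n + r) m (grad k) (tow k b) (S n) r Hk
    (grad_tower h Hh k _ Hk) TB) by lia.
  replace (n + S r)%nat with (S n + r)%nat by lia. reflexivity.
Qed.

End Forms.

(** * Brackets of towers *)

Lemma sum_f_R0_rev f n : sum_f_R0 (fun i => f (n - i)%nat) n = sum_f_R0 f n.
Proof.
induction n as [|n IH]; [reflexivity|].
rewrite decomp_sum by lia. rewrite (tech5 f). simpl pred.
rewrite <- IH. rewrite Nat.sub_0_r. cbn [Nat.sub]. ring.
Qed.

(* Sums over the two planes i + j + l = n and i + j + l = n - 1, reduced to the
   faces of the first by telescoping in l. *)
Lemma face_sums (n : nat) (t t1 t2 : nat -> nat -> nat -> R) :
  (forall i j l, (i + j + l)%nat = n -> t i j l + t1 i j l + t2 i j l = 0) ->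
  (forall i j l, S (i + j + l) = n -> t (S i) j l + t1 i (S j) l + t2 i j (S l) = 0) ->
  sum_f_R0 (fun j => t 0%nat j (n - j)%nat) n +
  sum_f_R0 (fun l => t1 (n - l)%nat 0%nat l) n +
  sum_f_R0 (fun i => t2 i (n - i)%nat 0%nat) n = 0.
Proof.
intros Ha Hb.
set (c := fun l => t 0%nat (n - l)%nat l + t1 (n - l)%nat 0%nat l).
(* Q l sums t + t1 over the row with third index l, and c l is made of the two ends of that row. In
   the interior, [Hb] replaces t + t1 by - t2 at height l + 1, which [Ha] converts into the row Q (S
   l). *)
set (Q := fun l => sum_f_R0 (fun i => t i (n - l - i)%nat l + t1 i (n - l - i)%nat l) (n - l)).
assert (Step : forall l, (l < n)%nat -> Q l = c l + Q (S l)).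
{ intros l Hl. unfold Q, c.
  replace (n - S l)%nat with (pred (n - l)) by lia.
  assert (HN : exists N, (n - l)%nat = S N) by (exists (n - l - 1)%nat; lia).
  destruct HN as [N HN]. rewrite HN. simpl pred.
  rewrite sum_plus, decomp_sum by lia. rewrite (tech5 (fun i => t1 i (S N - i)%nat l)). simpl pred.
  rewrite Nat.sub_0_r, Nat.sub_diag.
  assert (E : sum_f_R0 (fun i => t (S i) (S N - S i)%nat l) N +
     sum_f_R0 (fun i => t1 i (S N - i)%nat l) N =
     sum_f_R0 (fun i => t i (N - i)%nat (S l) + t1 i (N - i)%nat (S l)) N).
  { rewrite <- sum_plus. apply sum_eq. intros i Hi.
    replace (S N - i)%nat with (S (N - i)) by lia. cbn [Nat.sub].
    specialize (Ha i (N - i)%nat (S l) ltac:(lia)).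
    specialize (Hb i (N - i)%nat l ltac:(lia)). lra. }
  rewrite <- E. ring. }
assert (Tel : forall L, (L <= n)%nat -> Q 0%nat + c L = sum_f_R0 c L + Q L).
{ induction L as [|L IH]; intros HL; [simpl; ring|].
  specialize (IH ltac:(lia)). specialize (Step L ltac:(lia)). rewrite tech5. lra. }
specialize (Tel n (Nat.le_refl n)).
assert (Qn : Q n = c n).
{ unfold Q, c. rewrite Nat.sub_diag. simpl. ring. }
assert (E0 : Q 0%nat = - sum_f_R0 (fun i => t2 i (n - i)%nat 0%nat) n).
{ unfold Q. rewrite Nat.sub_0_r. apply Rplus_opp_r_uniq. rewrite Rplus_comm, <- sum_plus.
  rewrite (sum_eq _ (fun _ => 0)); [rewrite sum_cte; ring|].
  intros i Hi. exact (Ha i (n - i)%nat 0%nat ltac:(lia)). }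
assert (Ec : sum_f_R0 c n = sum_f_R0 (fun j => t 0%nat j (n - j)%nat) n +
  sum_f_R0 (fun l => t1 (n - l)%nat 0%nat l) n).
{ unfold c. rewrite sum_plus. f_equal.
  rewrite <- (sum_f_R0_rev (fun j => t 0%nat j (n - j)%nat)). apply sum_eq. intros i Hi.
  f_equal. lia. }
lra.
Qed.

(** The coefficient of z^n in the bracket of the generating series of f and g. *)
Definition bsum (f g : nat -> R -> R) (n : nat) : R -> R :=
  fun s => sum_f_R0 (fun j => bracket (f j) (g (n - j)%nat) s) n.

Lemma smooth_bracket f g : smooth f -> smooth g -> smooth (bracket f g).
Proof. intros Hf Hg. unfold bracket. smo. Qed.

Lemma smooth_sum (F : nat -> R -> R) n : (forall j, smooth (F j)) ->
  smooth (fun s => sum_f_R0 (fun j => F j s) n).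
Proof.
intros H. induction n as [|n IH]; [apply (H 0%nat)|].
exact (smooth_plus _ _ IH (H (S n))).
Qed.

Lemma loop_sum (F : nat -> R -> R) n : (forall j, (j <= n)%nat -> loop (F j)) ->
  loop (fun s => sum_f_R0 (fun j => F j s) n).
Proof.
induction n as [|n IH]; intros H; [apply (H 0%nat); lia|].
apply (loop_plus (fun s => sum_f_R0 (fun j => F j s) n) (F (S n))); auto.
Qed.

Lemma integral_sum (F : nat -> R -> R) n : (forall j, (j <= n)%nat -> loop (F j)) ->
  integral_S1 (fun s => sum_f_R0 (fun j => F j s) n) = sum_f_R0 (fun j => integral_S1 (F j)) n.
Proof.
induction n as [|n IH]; intros H; [reflexivity|].
simpl. rewrite <- IH by auto.
apply (integral_plus (fun s => sum_f_R0 (fun j => F j s) n) (F (S n))); auto.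
apply loop_sum. auto.
Qed.

Lemma Pop_sum k (F : nat -> R -> R) n : (forall j, smooth (F j)) ->
  Pop k (fun s => sum_f_R0 (fun j => F j s) n) = fun s => sum_f_R0 (fun j => Pop k (F j) s) n.
Proof.
intros H. induction n as [|n IH]; [reflexivity|].
simpl. rewrite (Pop_plus k (fun s => sum_f_R0 (fun j => F j s) n) (F (S n))); auto.
- now rewrite IH.
- now apply smooth_sum.
Qed.

Lemma Derive_sum (F : nat -> R -> R) n : (forall j, smooth (F j)) ->
  Derive (fun s => sum_f_R0 (fun j => F j s) n) = fun s => sum_f_R0 (fun j => Derive (F j) s) n.
Proof.
intros H. induction n as [|n IH]; [reflexivity|].
simpl. rewrite (Derive_plus_fun (fun s => sum_f_R0 (fun j => F j s) n) (F (S n))); auto.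
- now rewrite IH.
- now apply smooth_sum.
Qed.

(** Expand D and P of the brackets by their cocycle properties. Since D f_(j+1) = P f_j, and
    likewise for g, the Lie derivatives on the two sides agree except for one term at each end. *)
Lemma bsum_step k f g n s : smooth k -> (forall j, smooth (f j)) -> (forall j, smooth (g j)) ->
  (forall j, Derive (f (S j)) = Pop k (f j)) -> (forall j, Derive (g (S j)) = Pop k (g j)) ->
  Derive (bsum f g (S n)) s =
  Pop k (bsum f g n) s + lie2 (f (S n)) (Derive (g 0%nat)) s - lie2 (g (S n)) (Derive (f 0%nat)) s.
Proof.
intros Hk Hf Hg Df Dg. unfold bsum.
rewrite Pop_sum by (intros; now apply smooth_bracket).
rewrite Derive_sum by (intros; now apply smooth_bracket).
rewrite (sum_eq (fun j => Derive (bracket (f j) (g (S n - j)%nat)) s)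
  (fun j => lie2 (f j) (Derive (g (S n - j)%nat)) s - lie2 (g (S n - j)%nat) (Derive (f j)) s))
  by (intros; now apply Derive_bracket).
rewrite (sum_eq (fun j => Pop k (bracket (f j) (g (n - j)%nat)) s)
  (fun j => lie2 (f j) (Derive (g (S n - j)%nat)) s - lie2 (g (n - j)%nat) (Derive (f (S j))) s)).
2: { intros j Hj. rewrite Pop_bracket by auto. replace (S n - j)%nat with (S (n - j)) by lia.
     now rewrite Df, Dg. }
rewrite !minus_sum.
rewrite (tech5 (fun j => lie2 (f j) (Derive (g (S n - j)%nat)) s)).
rewrite (decomp_sum (fun j => lie2 (g (S n - j)%nat) (Derive (f j)) s)) by lia.
simpl pred. rewrite Nat.sub_diag, Nat.sub_0_r. cbn [Nat.sub]. ring.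
Qed.

(** The three integrals are the faces of the triangle i + j + l = n in [face_sums]. On that plane
    f_s [g, h] + cyclic terms vanish pointwise; on the plane n - 1 the relations D f_(i+1) = P f_i
    and so on lead to [Pop_cocycle]. *)
Lemma bsum_cyclic k n f g h : loop k -> is_tower k n f -> is_tower k n g -> is_tower k n h ->
  integral_S1 (fun s => Derive (f 0%nat) s * bsum g h n s) +
  integral_S1 (fun s => Derive (g 0%nat) s * bsum h f n s) +
  integral_S1 (fun s => Derive (h 0%nat) s * bsum f g n s) = 0.
Proof.
intros Hk Tf Tg Th.
assert (E : forall f g h, is_tower k n f -> is_tower k n g -> is_tower k n h ->
  integral_S1 (fun s => Derive (f 0%nat) s * bsum g h n s) =
  sum_f_R0 (fun j => integral_S1 (fun s => Derive (f 0%nat) s * bracket (g j) (h (n - j)%nat) s)) n).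
{ intros f' g' h' [Lf _] [Lg _] [Lh _].
  rewrite <- integral_sum.
  - apply integral_ext. intros s. unfold bsum. rewrite scal_sum. apply sum_eq. intros; ring.
  - intros j Hj. pose proof (Lf 0%nat ltac:(lia)).
    pose proof (loop_bracket (g' j) (h' (n - j)%nat) (Lg j Hj) (Lh (n - j)%nat ltac:(lia))). lo. }
rewrite !E by assumption.
apply (face_sums n
  (fun i j l => integral_S1 (fun s => Derive (f i) s * bracket (g j) (h l) s))
  (fun i j l => integral_S1 (fun s => Derive (g j) s * bracket (h l) (f i) s))
  (fun i j l => integral_S1 (fun s => Derive (h l) s * bracket (f i) (g j) s))).
- intros i j l Hn. destruct Tf as [Lf _], Tg as [Lg _], Th as [Lh _].
  specialize (Lf i ltac:(lia)). specialize (Lg j ltac:(lia)). specialize (Lh l ltac:(lia)).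
  pose proof (loop_bracket _ _ Lf Lg). pose proof (loop_bracket _ _ Lg Lh).
  pose proof (loop_bracket _ _ Lh Lf).
  rewrite <- !integral_plus by lo. rewrite <- integral_0. apply integral_ext.
  intros s. unfold bracket. ring.
- intros i j l Hn.
  rewrite (proj2 Tf i), (proj2 Tg j), (proj2 Th l) by lia.
  apply Pop_cocycle; [exact Hk|apply Tf; lia|apply Tg; lia|apply Th; lia].
Qed.

(** * Closedness *)

Lemma smooth_eq f g : smooth f -> smooth g -> f 0 = g 0 -> Derive f = Derive g -> f = g.
Proof.
intros Hf Hg H0 E. destruct (Derive_eq_const f g Hf Hg E) as [c ->].
apply functional_extensionality; intros s. replace c with 0 by lra. ring.
Qed.

Lemma primitive_0 f : primitive f 0 = 0.
Proof. apply (RInt_point (V := R_CompleteNormedModule)). Qed.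

Lemma Pop_opp k f : smooth f -> Pop k (fun s => - f s) = fun s => - Pop k f s.
Proof.
intros Hf. apply functional_extensionality; intros s. unfold Pop. dfun. ring.
Qed.

Lemma Pop_minus k f g : smooth f -> smooth g ->
  Pop k (fun s => f s - g s) = fun s => Pop k f s - Pop k g s.
Proof.
intros Hf Hg. apply functional_extensionality; intros s. unfold Pop. dfun. ring.
Qed.

Lemma Pop_const_0 k : Pop k (fun _ => 0) = fun _ => 0.
Proof.
apply functional_extensionality; intros s. unfold Pop. rewrite !Derive_const_fun. ring.
Qed.

(** * Exterior derivatives of the recursion towers over a family of curves *)

Section TowerFamily.
Context {V : NormedModule R_AbsRing} (G : V -> curve) (PG : plot M G).
Local Notation W := (prod_NormedModule R_AbsRing V R_NormedModule).
Local Notation K y := (curvature (G y)).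
Local Notation al v y := (slice (famA G v) y).

Definition famP (f : W -> R) : W -> R := fun p =>
  1 / 2 * ds (ds (ds f)) p + 2 * (famK G p * ds f p) + ds (famK G) p * f p.

(** The tower [tow] for all curves of the family at once; [Cinf_prim] makes it jointly smooth, so it
    can be differentiated in the parameters. *)
Fixpoint famT (v : V) (i : nat) : W -> R :=
  match i with
  | O => famA G v
  | S i => prim (famP (famT v i))
  end.

Lemma Cinf_P f : Cinf f -> Cinf (famP f).
Proof.
intros H. pose proof (Cinf_K G PG) as HK. pose proof (Cinf_ds _ HK) as HdK.
pose proof (Cinf_ds _ H) as H1. pose proof (Cinf_ds _ (Cinf_ds _ H1)) as H3.
apply (Cinf_plus (V := W) (fun p : W => 1 / 2 * ds (ds (ds f)) p + 2 * (famK G p * ds f p))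
  (fun p : W => ds (famK G) p * f p)).
- apply (Cinf_plus (V := W) (fun p : W => 1 / 2 * ds (ds (ds f)) p)
    (fun p : W => 2 * (famK G p * ds f p))).
  + exact (Cinf_mult (V := W) _ _ (Cinf_const (V := W) (1 / 2)) H3).
  + exact (Cinf_mult (V := W) _ _ (Cinf_const (V := W) 2) (Cinf_mult (V := W) _ _ HK H1)).
- exact (Cinf_mult (V := W) _ _ HdK H).
Qed.

Lemma Cinf_T v i : Cinf (famT v i).
Proof.
induction i as [|i IH]; [exact (Cinf_A G PG v)|]. apply Cinf_prim, Cinf_P, IH.
Qed.

Lemma ds_T v i : ds (famT v (S i)) = famP (famT v i).
Proof. apply ds_prim, Cinf_P, Cinf_T. Qed.

Lemma slice_P f y : Cinf f -> slice (famP f) y = Pop (K y) (slice f y).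
Proof.
intros H. pose proof (Cinf_K G PG) as HK. pose proof (Cinf_ds _ H) as H1.
pose proof (Cinf_ds _ H1) as H2.
apply functional_extensionality; intros s. unfold Pop.
change (K y) with (slice (famK G) y).
rewrite !Derive_slice by assumption. unfold slice, famP. ring.
Qed.

Lemma slice_T v i y : slice (famT v i) y = tow (K y) (al v y) i.
Proof.
induction i as [|i IH]; [reflexivity|].
change (primitive (slice (famP (famT v i)) y) = primitive (Pop (K y) (tow (K y) (al v y) i))).
now rewrite slice_P, IH by apply Cinf_T.
Qed.

Lemma dv_const_mult (u : V) (a : R) (f : W -> R) :
  dv u (fun p : W => a * f p) = fun p => a * dv u f p.
Proof. apply (ddir_scal (V := W)). Qed.

(** P involves the curve only through k, in an affine way; its variation applied to f is 2 k_u f_s +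
    k_us f, the Lie derivative of k_u along f. *)
Lemma slice_dv_P u f y : Cinf f ->
  slice (dv u (famP f)) y =
  fun s => Pop (K y) (slice (dv u f) y) s + lie2 (slice f y) (slice (dv u (famK G)) y) s.
Proof.
intros H. pose proof (Cinf_K G PG) as HK. pose proof (Cinf_ds _ HK) as HdK.
pose proof (Cinf_ds _ H) as H1. pose proof (Cinf_ds _ H1) as H2. pose proof (Cinf_ds _ H2) as H3.
pose proof (Cinf_dv u _ H) as Hu. pose proof (Cinf_dv u _ HK) as HKu.
pose proof (Cinf_mult (V := W) _ _ HK H1) as M1.
pose proof (Cinf_mult (V := W) _ _ (Cinf_const (V := W) (1 / 2)) H3) as M2.
pose proof (Cinf_mult (V := W) _ _ (Cinf_const (V := W) 2) M1) as M3.
pose proof (Cinf_mult (V := W) _ _ HdK H) as M4.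
pose proof (Cinf_plus (V := W) _ _ M2 M3) as M5.
assert (E : dv u (famP f) = fun p : W => 1 / 2 * dv u (ds (ds (ds f))) p +
  2 * (dv u (famK G) p * ds f p + famK G p * dv u (ds f) p) +
  (dv u (ds (famK G)) p * f p + ds (famK G) p * dv u f p)).
{ unfold famP.
  rewrite (dv_plus u _ _ M5 M4), (dv_plus u _ _ M2 M3), !dv_const_mult, (dv_mult u _ _ HK H1),
    (dv_mult u _ _ HdK H). reflexivity. }
rewrite E, <- !ds_dv by assumption.
apply functional_extensionality; intros s. unfold Pop, lie2.
change (K y) with (slice (famK G) y).
pose proof (Cinf_ds _ Hu) as Hu1. pose proof (Cinf_ds _ Hu1) as Hu2.
rewrite (Derive_slice _ y Hu), (Derive_slice _ y Hu1), (Derive_slice _ y Hu2),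
  (Derive_slice _ y HK), (Derive_slice _ y H), (Derive_slice _ y HKu).
unfold slice. ring.
Qed.

(** The exterior derivative of the function-valued one-form T_i on constant vector fields, for which
    the commutator term is absent. *)
Definition dT (u v : V) (i : nat) : W -> R := fun p => dv u (famT v i) p - dv v (famT u i) p.

Lemma Cinf_dT u v i : Cinf (dT u v i).
Proof.
exact (Cinf_minus (V := W) _ _ (Cinf_dv u _ (Cinf_T v i)) (Cinf_dv v _ (Cinf_T u i))).
Qed.

Lemma ds_dT u v i : ds (dT u v (S i)) =
  fun p => dv u (famP (famT v i)) p - dv v (famP (famT u i)) p.
Proof.
unfold dT. rewrite ds_minus by (apply Cinf_dv, Cinf_T).
now rewrite !ds_dv, !ds_T by apply Cinf_T.
Qed.

Lemma dT_at_0 u v i y : slice (dT u v (S i)) y 0 = 0.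
Proof.
unfold slice, dT. rewrite !dv_at by apply Cinf_T.
assert (E : forall w w', Derive (fun t : R => famT w' (S i) (plus y (scal t w), 0)) 0 = 0).
{ intros w w'. rewrite (Derive_ext _ (fun _ => 0)); [apply Derive_const|].
  intros t. apply primitive_0. }
rewrite !E. ring.
Qed.

Lemma famP_A u : famP (famA G u) = dv u (famK G).
Proof.
apply functional_extensionality; intros [y s].
change (slice (famP (famA G u)) y s = slice (dv u (famK G)) y s).
now rewrite slice_P, slice_dvK by (exact PG || apply (Cinf_A G PG)).
Qed.

(* The Maurer-Cartan equation for alpha. *)
Lemma slice_dT_0 u v y : slice (dT u v 0) y = bracket (al u y) (al v y).
Proof.
pose proof (Cinf_X G PG) as HX. pose proof (Cinf_Y G PG) as HY.
apply functional_extensionality; intros s.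
assert (E : forall u v, dv u (famA G v) = fun p : W =>
  dv u (famX G) p * dv v (famY G) p + famX G p * dv u (dv v (famY G)) p -
  (dv u (famY G) p * dv v (famX G) p + famY G p * dv u (dv v (famX G)) p)).
{ intros u' v'. pose proof (Cinf_dv v' _ HX) as HvX. pose proof (Cinf_dv v' _ HY) as HvY.
  unfold famA.
  rewrite dv_minus, !dv_mult; auto.
  - exact (Cinf_mult (V := W) _ _ HX HvY).
  - exact (Cinf_mult (V := W) _ _ HY HvX). }
unfold slice at 1. unfold dT. simpl famT. rewrite !E.
rewrite (dv_dv (famX G) v u HX), (dv_dv (famY G) v u HY).
transitivity (2 * det (velocity G y u s) (velocity G y v s)).
- rewrite !(velocity_dv G PG). unfold det. simpl. ring.
- rewrite !(velocity_tvec G PG), det_tvec_tvec by apply (family_M G PG).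
  unfold bracket. field.
Qed.

(** D T_1(u) = P alpha(u) is the variation of k along u, so D dT_1 = d(dk) = 0; the normalization at
    s = 0 removes the remaining constant. *)
Lemma slice_dT_1 u v y : slice (dT u v 1) y = fun _ => 0.
Proof.
apply smooth_eq.
- apply smooth_slice, Cinf_dT.
- apply smooth_const.
- apply dT_at_0.
- rewrite Derive_slice, ds_dT by apply Cinf_dT. simpl famT. rewrite !famP_A.
  rewrite Derive_const_fun, dv_dv by apply (Cinf_K G PG).
  apply functional_extensionality; intros s. unfold slice. ring.
Qed.

Lemma Derive_slice_dT u v i y s :
  Derive (slice (dT u v (S i)) y) s = Pop (K y) (slice (dT u v i) y) s
  + lie2 (tow (K y) (al v y) i) (slice (dv u (famK G)) y) s
  - lie2 (tow (K y) (al u y) i) (slice (dv v (famK G)) y) s.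
Proof.
pose proof (smooth_slice _ y (Cinf_dv u _ (Cinf_T v i))) as S1.
pose proof (smooth_slice _ y (Cinf_dv v _ (Cinf_T u i))) as S2.
rewrite Derive_slice, ds_dT by apply Cinf_dT.
change (slice (dv u (famP (famT v i))) y s - slice (dv v (famP (famT u i))) y s =
  Pop (K y) (fun s => slice (dv u (famT v i)) y s - slice (dv v (famT u i)) y s) s
  + lie2 (tow (K y) (al v y) i) (slice (dv u (famK G)) y) s
  - lie2 (tow (K y) (al u y) i) (slice (dv v (famK G)) y) s).
rewrite !slice_dv_P, !slice_T by apply Cinf_T. rewrite Pop_minus by assumption. ring.
Qed.

(** Dropping T_0 leaves entries that all vanish at s = 0, and the derivative of entry 0 is the
    variation of k. *)
Definition shifted (v : V) (y : V) : nat -> R -> R := fun j => tow (K y) (al v y) (S j).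

Lemma bsum_at_0 u v y n : bsum (shifted u y) (shifted v y) n 0 = 0.
Proof.
unfold bsum. rewrite (sum_eq _ (fun _ => 0)); [rewrite sum_cte; ring|].
intros j _. unfold bracket. unfold shifted; simpl tow. rewrite !primitive_0. ring.
Qed.

Lemma smooth_bsum f g n : (forall j, smooth (f j)) -> (forall j, smooth (g j)) ->
  smooth (bsum f g n).
Proof.
intros Hf Hg. apply (smooth_sum (fun j => bracket (f j) (g (n - j)%nat))).
intros j. now apply smooth_bracket.
Qed.

(** Both sides vanish at s = 0 and have equal derivatives: the end terms in [bsum_step] are the Lie
    derivatives of k_u and k_v in [Derive_slice_dT]. The induction starts from dT_1 = 0. *)
Lemma slice_dT_SS u v y n :
  slice (dT u v (S (S n))) y = fun s => - bsum (shifted u y) (shifted v y) n s.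
Proof.
pose proof (proj1 (loop_slice_K G PG y)) as Sk. change (slice (famK G) y) with (K y) in Sk.
pose proof (proj1 (loop_slice_A G PG u y)) as Su. pose proof (proj1 (loop_slice_A G PG v y)) as Sv.
assert (Hu : forall j, smooth (shifted u y j)) by (intros; now apply smooth_tow).
assert (Hv : forall j, smooth (shifted v y j)) by (intros; now apply smooth_tow).
assert (Du : forall j, Derive (shifted u y (S j)) = Pop (K y) (shifted u y j))
  by (intros; now apply Derive_tow).
assert (Dv : forall j, Derive (shifted v y (S j)) = Pop (K y) (shifted v y j))
  by (intros; now apply Derive_tow).
assert (Hb : forall n, smooth (bsum (shifted u y) (shifted v y) n))
  by (intros; now apply smooth_bsum).
assert (Ku : slice (dv u (famK G)) y = Derive (shifted u y 0)).
{ rewrite (slice_dvK G PG). symmetry. now apply (Derive_tow (K y) (al u y) 0). }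
assert (Kv : slice (dv v (famK G)) y = Derive (shifted v y 0)).
{ rewrite (slice_dvK G PG). symmetry. now apply (Derive_tow (K y) (al v y) 0). }
induction n as [|n IH].
- apply smooth_eq.
  + apply smooth_slice, Cinf_dT.
  + apply smooth_opp, Hb.
  + rewrite dT_at_0, bsum_at_0. ring.
  + rewrite Derive_opp_fun. apply functional_extensionality; intros s.
    rewrite Derive_slice_dT, slice_dT_1, Ku, Kv. unfold bsum. simpl sum_f_R0.
    rewrite (Pop_const_0 (K y)).
    change (0 + lie2 (shifted v y 0) (Derive (shifted u y 0)) s
      - lie2 (shifted u y 0) (Derive (shifted v y 0)) s =
      - Derive (bracket (shifted u y 0) (shifted v y 0)) s).
    rewrite Derive_bracket by auto. ring.
- apply smooth_eq.
  + apply smooth_slice, Cinf_dT.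
  + apply smooth_opp, Hb.
  + rewrite dT_at_0, bsum_at_0. ring.
  + rewrite Derive_opp_fun. apply functional_extensionality; intros s.
    rewrite Derive_slice_dT, IH, Ku, Kv, (bsum_step (K y)) by assumption.
    rewrite Pop_opp by apply Hb.
    change (tow (K y) (al u y) (S (S n))) with (shifted u y (S n)).
    change (tow (K y) (al v y) (S (S n))) with (shifted v y (S n)). ring.
Qed.

End TowerFamily.

(** * Exterior derivatives of the forms on families inside M(C_m) *)

Section Closed.
Context {V : NormedModule R_AbsRing} (h : nat -> dpoly) (Hh : kdv_densities h)
  (c : nat -> R) (m : nat) (Hm : (1 <= m)%nat) (G : V -> curve) (PG : plot (MC h c m) G).
Local Notation W := (prod_NormedModule R_AbsRing V R_NormedModule).
Local Notation K y := (curvature (G y)).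
Local Notation al v y := (slice (famA G v) y).

Let PM : plot M G.
Proof.
destruct PG as [H1 [H2 H3]]. split; [exact H1|split; [exact H2|]]. intros y. apply H3.
Qed.

Lemma velocity_fun y v : velocity G y v = tvec (G y) (al v y).
Proof. apply functional_extensionality; intros s. now apply velocity_tvec. Qed.

(** H_j has the constant value c_j along the family, so its first variation vanishes. *)
Lemma velocity_TMC y v : TMC h m (G y) (velocity G y v).
Proof.
pose proof (loop_slice_A G PM v y) as La.
rewrite velocity_fun. split; [exists (al v y); split; [exact La|reflexivity]|].
intros j Hj. apply is_dH_iff; [apply (family_M G PM)|exact La|].
rewrite <- (is_derive_unique _ _ _ (first_variation G PM (h j) y v)).
rewrite (Derive_ext _ (fun _ => c j)); [symmetry; apply Derive_const|].
intros t. destruct PG as [_ [_ HG]]. now apply (HG (plus y (scal t v))).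
Qed.

Lemma tower_T y v : is_tower (K y) m (tow (K y) (al v y)).
Proof.
destruct (TMC_tower (G y) (family_M G PM y) h Hh m _ Hm (velocity_TMC y v))
  as [a [_ [Ea [TA _]]]].
rewrite velocity_fun in Ea.
assert (E : al v y = a).
{ apply (tvec_inj (G y) (family_M G PM y)). intros s. now rewrite Ea. }
now rewrite E.
Qed.

(* Twice omega_r is [theta ^ D phi] with theta, phi the p-th and q-th primitives
   of the recursion tower. *)
Definition form_indices (r : nat) : nat * nat :=
  match r with
  | O => (0, 0)%nat
  | S O => (0, 1)%nat
  | S (S n) => (1, S n)%nat
  end.

(** Antisymmetrized before integration, so that the cyclic sum of derivatives is expressed pointwise
    by [dT]. *)
Definition famF (p q : nat) (v e : V) : W -> R := fun z =>
  1 / 2 * (famT G v p z * ds (famT G e q) z - famT G e p z * ds (famT G v q) z).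

Lemma Cinf_F p q v e : Cinf (famF p q v e).
Proof.
pose proof (Cinf_T G PM v p) as H1. pose proof (Cinf_T G PM e p) as H2.
pose proof (Cinf_ds _ (Cinf_T G PM e q)) as H3. pose proof (Cinf_ds _ (Cinf_T G PM v q)) as H4.
exact (Cinf_mult (V := W) _ _ (Cinf_const (V := W) (1 / 2))
  (Cinf_minus (V := W) _ _ (Cinf_mult (V := W) _ _ H1 H3) (Cinf_mult (V := W) _ _ H2 H4))).
Qed.

Lemma slice_F p q v e y s : slice (famF p q v e) y s =
  1 / 2 * (tow (K y) (al v y) p s * Derive (tow (K y) (al e y) q) s
         - tow (K y) (al e y) p s * Derive (tow (K y) (al v y) q) s).
Proof.
rewrite <- !(slice_T G PM), !Derive_slice by apply (Cinf_T G PM). reflexivity.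
Qed.

Lemma loop_slice_F p q v e y : (p <= m)%nat -> (q <= m)%nat -> loop (slice (famF p q v e) y).
Proof.
intros Hp Hq.
rewrite (functional_extensionality _ _ (slice_F p q v e y)).
pose proof (proj1 (tower_T y v) p Hp). pose proof (proj1 (tower_T y e) p Hp).
pose proof (proj1 (tower_T y v) q Hq). pose proof (proj1 (tower_T y e) q Hq). lo.
Qed.

(** For r = n + 2 the integral of alpha(v) P T_(n+1)(e) becomes that of T_1(v) D T_(n+1)(e), by
    skew-symmetry of P and of D. This replaces alpha by the closed T_1 and keeps both indices at
    most m; [omega_skew] then justifies the antisymmetrization. *)
Lemma omega_F r v e y : (r <= m + 1)%nat ->
  omega r (G y) (velocity G y v) (velocity G y e) =
  integral_S1 (slice (famF (fst (form_indices r)) (snd (form_indices r)) v e) y).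
Proof.
intros Hr. set (p := fst (form_indices r)). set (q := snd (form_indices r)).
pose proof (family_M G PM y) as My. pose proof (loop_slice_K G PM y) as Lk.
change (slice (famK G) y) with (K y) in Lk.
pose proof (loop_slice_A G PM v y) as Lv. pose proof (loop_slice_A G PM e y) as Le.
assert (Hp : (p <= m)%nat) by (unfold p; destruct r as [|[|r]]; simpl; lia).
assert (Hq : (q <= m)%nat) by (unfold q; destruct r as [|[|r]]; simpl; lia).
assert (E : forall v e, omega r (G y) (velocity G y v) (velocity G y e) =
  integral_S1 (fun s => tow (K y) (al v y) p s * Derive (tow (K y) (al e y) q) s)).
{ clear v e Lv Le. intros v e.
  pose proof (loop_slice_A G PM v y) as Lv. pose proof (loop_slice_A G PM e y) as Le.
  pose proof (tower_T y v) as Tv. pose proof (tower_T y e) as Te.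
  rewrite !velocity_fun, (omega_eq (G y) My m r _ _ Lv Le Tv Te Hr).
  destruct r as [|[|n]]; try reflexivity. unfold p, q. simpl fst. simpl snd.
  rewrite (Derive_tow (K y) (al e y) (S n) (proj1 Lk) (proj1 Le)).
  assert (L1 : loop (tow (K y) (al e y) (S n))) by (apply Te; lia).
  rewrite (Pop_skew (K y) _ _ Lk Lv L1).
  assert (L2 : loop (tow (K y) (al v y) 1)) by (apply Tv; lia).
  rewrite (integral_parts _ _ L2 L1).
  now rewrite (Derive_tow (K y) (al v y) 0 (proj1 Lk) (proj1 Lv)). }
assert (Sk := omega_skew (G y) My m r _ _ Lv Le (tower_T y v) (tower_T y e) Hr).
rewrite <- (omega_eq (G y) My m r _ _ Le Lv (tower_T y e) (tower_T y v) Hr),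
  <- (omega_eq (G y) My m r _ _ Lv Le (tower_T y v) (tower_T y e) Hr), <- !velocity_fun, !E in Sk.
rewrite E.
rewrite (integral_ext _ _ (slice_F p q v e y)).
pose proof (proj1 (tower_T y v) p Hp). pose proof (proj1 (tower_T y e) p Hp).
pose proof (proj1 (tower_T y v) q Hq). pose proof (proj1 (tower_T y e) q Hq).
rewrite integral_scal, integral_minus by lo. lra.
Qed.

Lemma dv_F p q u v e : dv u (famF p q v e) = fun z : W => 1 / 2 *
  (dv u (famT G v p) z * ds (famT G e q) z + famT G v p z * ds (dv u (famT G e q)) z
   - (dv u (famT G e p) z * ds (famT G v q) z + famT G e p z * ds (dv u (famT G v q)) z)).
Proof.
pose proof (Cinf_T G PM v p) as H1. pose proof (Cinf_T G PM e p) as H2.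
pose proof (Cinf_ds _ (Cinf_T G PM e q)) as H3. pose proof (Cinf_ds _ (Cinf_T G PM v q)) as H4.
unfold famF. rewrite dv_const_mult.
rewrite (dv_minus u _ _ (Cinf_mult (V := W) _ _ H1 H3) (Cinf_mult (V := W) _ _ H2 H4)).
rewrite (dv_mult u _ _ H1 H3), (dv_mult u _ _ H2 H4), !ds_dv by apply (Cinf_T G PM).
reflexivity.
Qed.

(** The Leibniz rule d(theta ^ D phi) = d theta ^ D phi - theta ^ D d phi, with D and d
    commuting. *)
Lemma cyclic_dF p q u v e y s :
  slice (dv u (famF p q v e)) y s + slice (dv v (famF p q e u)) y s
    + slice (dv e (famF p q u v)) y s =
  1 / 2 *
  (Derive (tow (K y) (al e y) q) s * slice (dT G u v p) y s
   + Derive (tow (K y) (al u y) q) s * slice (dT G v e p) y s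
   + Derive (tow (K y) (al v y) q) s * slice (dT G e u p) y s
   - (tow (K y) (al e y) p s * Derive (slice (dT G u v q) y) s
      + tow (K y) (al u y) p s * Derive (slice (dT G v e q) y) s
      + tow (K y) (al v y) p s * Derive (slice (dT G e u q) y) s)).
Proof.
rewrite <- !(slice_T G PM), !(Derive_slice (famT _ _ _)) by apply (Cinf_T G PM).
rewrite !Derive_slice by apply (Cinf_dT G PM).
rewrite !dv_F. unfold dT.
rewrite !ds_minus by apply Cinf_dv, (Cinf_T G PM).
unfold slice. ring.
Qed.

Lemma cyclic_integral r u v e y : (r <= m + 1)%nat ->
  let p := fst (form_indices r) in let q := snd (form_indices r) in
  integral_S1 (fun s => slice (dv u (famF p q v e)) y s + slice (dv v (famF p q e u)) y s
    + slice (dv e (famF p q u v)) y s) = 0.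
Proof.
intros Hr p q.
rewrite (integral_ext _ _ (cyclic_dF p q u v e y)).
pose proof (loop_slice_K G PM y) as Lk. change (slice (famK G) y) with (K y) in Lk.
pose proof (loop_slice_A G PM u y) as Lu. pose proof (loop_slice_A G PM v y) as Lv.
pose proof (loop_slice_A G PM e y) as Le.
destruct r as [|[|[|n]]]; unfold p, q; simpl fst; simpl snd; clear p q.
(* omega_0: by the Maurer-Cartan equation the integrand consists of alpha and its brackets, and its
   cyclic sum vanishes pointwise. *)
- rewrite <- integral_0. apply integral_ext. intros s.
  rewrite !(slice_dT_0 G PM). simpl tow. rewrite !Derive_bracket by (eapply proj1; eassumption).
  unfold bracket, lie2. ring.
(* omega_1: with dT_1 = 0 and D T_1 = P alpha, the cocycle identity of P is all that is left. *)
- rewrite <- (Rmult_0_r (1 / 2)), <- (Pop_cocycle (K y) (al e y) (al u y) (al v y) Lk Le Lu Lv).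
  pose proof (loop_Pop _ _ Lk Le). pose proof (loop_Pop _ _ Lk Lu). pose proof (loop_Pop _ _ Lk Lv).
  pose proof (loop_bracket _ _ Lu Lv). pose proof (loop_bracket _ _ Lv Le).
  pose proof (loop_bracket _ _ Le Lu).
  rewrite <- !integral_plus, <- integral_scal by lo.
  apply integral_ext. intros s.
  rewrite !(slice_dT_0 G PM), !(slice_dT_1 G PM), !Derive_const.
  rewrite !Derive_tow by (eapply proj1; eassumption). simpl tow. ring.
(* omega_2: both indices are 1 and dT_1 = 0. *)
- rewrite <- integral_0. apply integral_ext. intros s.
  rewrite !(slice_dT_1 G PM), !Derive_const. ring.
(* omega_(n+3): only T_1 ^ D dT_(n+2) survives; integration by parts puts D on T_1, and
   [bsum_cyclic] applies to the towers starting at T_1. *)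
- assert (TS : forall w, is_tower (K y) n (shifted G w y)).
  { intros w. pose proof (tower_T y w) as T. split; intros i Hi; [apply T; lia|].
    apply (proj2 T (S i)). lia. }
  assert (LS : forall w j, (j <= n)%nat -> loop (shifted G w y j)) by (intros w j Hj; now apply TS).
  assert (LB : forall w w', loop (bsum (shifted G w y) (shifted G w' y) n)).
  { intros w w'. apply (loop_sum (fun j => bracket (shifted G w y j) (shifted G w' y (n - j)%nat))).
    intros j Hj. apply loop_bracket; apply LS; lia. }
  assert (C := bsum_cyclic (K y) n _ _ _ Lk (TS e) (TS u) (TS v)).
  pose proof (LB u v) as B1. pose proof (LB v e) as B2. pose proof (LB e u) as B3.
  pose proof (LS u 0%nat ltac:(lia)) as S1. pose proof (LS v 0%nat ltac:(lia)) as S2.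
  pose proof (LS e 0%nat ltac:(lia)) as S3.
  assert (P1 := integral_parts _ _ S3 B1). assert (P2 := integral_parts _ _ S1 B2).
  assert (P3 := integral_parts _ _ S2 B3).
  rewrite (integral_ext _ (fun s => 1 / 2 *
    (shifted G e y 0 s * Derive (bsum (shifted G u y) (shifted G v y) n) s
     + shifted G u y 0 s * Derive (bsum (shifted G v y) (shifted G e y) n) s
     + shifted G v y 0 s * Derive (bsum (shifted G e y) (shifted G u y) n) s))).
  + rewrite integral_scal, !integral_plus by lo. lra.
  + intros s. rewrite !(slice_dT_1 G PM), !(slice_dT_SS G PM), !Derive_opp.
    change (tow (K y) (al e y) 1 s) with (shifted G e y 0 s).
    change (tow (K y) (al u y) 1 s) with (shifted G u y 0 s).
    change (tow (K y) (al v y) 1 s) with (shifted G v y 0 s).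
    change (fun x : R => bsum ?f ?g n x) with (bsum f g n). ring.
Qed.

Lemma closed_omega r x u v e : (r <= m + 1)%nat ->
  let pb (a b y : V) := omega r (G y) (velocity G y a) (velocity G y b) in
  exists l1 l2 l3 : R,
    is_derive (fun t : R => pb v e (plus x (scal t u))) 0 l1 /\
    is_derive (fun t : R => pb e u (plus x (scal t v))) 0 l2 /\
    is_derive (fun t : R => pb u v (plus x (scal t e))) 0 l3 /\
    l1 + l2 + l3 = 0.
Proof.
intros Hr pb. set (p := fst (form_indices r)). set (q := snd (form_indices r)).
assert (Hp : (p <= m)%nat) by (unfold p; destruct r as [|[|r]]; simpl; lia).
assert (Hq : (q <= m)%nat) by (unfold q; destruct r as [|[|r]]; simpl; lia).
assert (D : forall u v e, is_derive (fun t : R => pb v e (plus x (scal t u))) 0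
  (integral_S1 (slice (dv u (famF p q v e)) x))).
{ intros u' v' e'.
  apply is_derive_ext with (fun t : R => integral_S1 (slice (famF p q v' e') (plus x (scal t u')))).
  - intros t. symmetry. now apply omega_F.
  - apply is_derive_integral0, Cinf_F. }
do 3 eexists. split; [apply D|split; [apply D|split; [apply D|]]].
assert (L : forall u v e, loop (slice (dv u (famF p q v e)) x)).
{ intros u' v' e'. apply loop_slice_dv; [apply Cinf_F|]. intros y. now apply loop_slice_F. }
pose proof (L u v e). pose proof (L v e u). pose proof (L e u v).
rewrite <- !integral_plus by lo. now apply cyclic_integral.
Qed.

End Closed.

Theorem theorem7 (h : nat -> dpoly) (c : nat -> R) (m : nat)
  (Hh : kdv_densities h) (Hm : (1 <= m)%nat)
  (Hne : exists g, MC h c m g) :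
  (forall k, (k <= m + 1)%nat -> presymplectic (MC h c m) (TMC h m) k) /\
  (forall n k, (1 <= n)%nat -> (k <= m + 1)%nat ->
     hamiltonian_field (MC h c m) (TMC h m) (omega k)
       (KdV_field n) (Ham (h (n + k)%nat))).
Proof.
split.
- intros r Hr. split; [|split; [|split]].
  + intros g X Y [Mg _] HX HY.
    destruct (TMC_tower g Mg h Hh m X Hm HX) as [a [Ha [-> [TA _]]]].
    destruct (TMC_tower g Mg h Hh m Y Hm HY) as [b [Hb [-> [TB _]]]].
    eexists. split.
    * now apply (is_omega_iff g Mg m r a b).
    * intros l Hl. symmetry. now apply (is_omega_iff g Mg m r a b).
  + intros g X Y [Mg _] HX HY.
    destruct (TMC_tower g Mg h Hh m X Hm HX) as [a [Ha [-> [TA _]]]].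
    destruct (TMC_tower g Mg h Hh m Y Hm HY) as [b [Hb [-> [TB _]]]].
    rewrite !(omega_eq g Mg m) by assumption. now apply (omega_skew g Mg m).
  + intros g X X' Y q q' [Mg _] HX HX' HY.
    destruct (TMC_tower g Mg h Hh m X Hm HX) as [a [Ha [-> [TA _]]]].
    destruct (TMC_tower g Mg h Hh m X' Hm HX') as [a' [Ha' [-> [TA' _]]]].
    destruct (TMC_tower g Mg h Hh m Y Hm HY) as [b [Hb [-> [TB _]]]].
    pose proof (M_loop_k g Mg) as Hk.
    replace (fun s => comb q (tvec g a s) q' (tvec g a' s))
      with (tvec g (fun s => q * a s + q' * a' s)).
    * assert (Ls : loop (fun s => q * a s + q' * a' s)) by lo.
      rewrite (omega_eq g Mg m r _ b Ls Hb (tower_linear _ m a a' q q' Hk Ha Ha' TA TA') TB Hr).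
      rewrite !(omega_eq g Mg m) by assumption.
      (* For r = m + 1 the entry T_r itself is not known to be periodic, but its derivative P T_m
         is. *)
      assert (LD : loop (Derive (tow (curvature g) b r))).
      { destruct r as [|r]; [now apply loop_Derive|].
        rewrite Derive_tow by (eapply proj1; eassumption).
        apply loop_Pop; [exact Hk|apply TB; lia]. }
      set (E := Derive (tow (curvature g) b r)) in *.
      rewrite <- !integral_scal, <- integral_plus by lo. apply integral_ext. intros s. ring.
    * apply functional_extensionality; intros s. unfold tvec, comb. simpl.
      rewrite (Derive_plus_fun (fun s => q * a s) (fun s => q' * a' s)),
        !Derive_mult_fun, !Derive_const_fun by (pose proof (proj1 Ha); pose proof (proj1 Ha'); smo).
      f_equal; ring.
  + intros G PG x u v e. exact (closed_omega h Hh c m Hm G PG r x u v e Hr).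
- intros n r Hn Hr g [Mg _]. split.
  + now apply KdV_field_TMC.
  + intros Y HY. now apply (KdV_hamiltonian g Mg h Hh n m r Y).
Qed.
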